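(* For every $\delta > 0$ there exists a constant $C_\delta$ such that for all positive integers $f, w$, $$|T(f,w)| \le C_\delta^f\, f^{f/2}\, w^{-(1-\delta) w}.$$
   Context: A triangulated surface is a finite simplicial complex which is homeomorphic to a closed 2-dimensional manifold (orientable or not). $T(f,w)$ denotes the set of connected triangulated closed surfaces with exactly $f$ 2-faces and exactly $w$ vertices, up to simplicial isomorphism. *)

(* Defs.v *)
From mathcomp Require Import all_boot all_fingroup all_order all_algebra.

Set Implicit Arguments.
Unset Strict Implicit.
Unset Printing Implicit Defensive.

(* Finite abstract simplicial complexes whose vertex set is exactly 'I_w,
   given by their nonempty faces. *)

Definition simplicial_complex (w : nat) (K : {set {set 'I_w}}) : bool :=
  [&& set0 \notin K,
      [forall v : 'I_w, [set v] \in K]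
    & [forall s in K, forall t : {set 'I_w},
        (t != set0) && (t \subset s) ==> (t \in K)]].

Definition two_faces (w : nat) (K : {set {set 'I_w}}) : {set {set 'I_w}} :=
  [set s in K | #|s| == 3].

Definition simplicial_iso (w : nat) (K L : {set {set 'I_w}}) : bool :=
  [exists g : {perm 'I_w}, forall s : {set 'I_w},
    (s \in K) == ([set g v | v in s] \in L)].

Definition face_support (R : nmodType) (w : nat) (x : 'rV[R]_w) : {set 'I_w} :=
  [set v | x ord0 v != 0%R].

From mathcomp Require Import all_classical all_reals all_analysis.

Import Order.TTheory GRing.Theory Num.Theory.
Import numFieldNormedType.Exports.

Local Open Scope classical_set_scope.
Local Open Scope ring_scope.

(* The vertices of K are realized as the standard basis vectors of R^w. *)
Definition realization (R : realType) (w : nat) (K : {set {set 'I_w}}) :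
    set 'rV[R]_w :=
  [set x : 'rV[R]_w | [/\ forall v, 0 <= x ord0 v,
                           \sum_v x ord0 v = 1
                         & face_support x \in K]].

Definition homeomorphic (X Y : topologicalType) : Prop :=
  exists (h : X -> Y) (k : Y -> X),
    [/\ cancel h k, cancel k h, continuous h & continuous k].

(* A set used as a space (here U and V) carries the subspace topology through
   set_type. *)
Definition locally_euclidean (R : realType) (n : nat) (M : topologicalType) :
    Prop :=
  forall p : M, exists (U : set M) (V : set 'rV[R]_n),
    [/\ open U, U p, open V & homeomorphic (set_type U) (set_type V)].

Definition closed_manifold (R : realType) (n : nat) (M : topologicalType) :
    Prop :=
  [/\ hausdorff_space M, @second_countable M, locally_euclidean R n M
    & compact [set: M]].

Definition triangulated_surface (R : realType) (w : nat)
    (K : {set {set 'I_w}}) : Prop :=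
  simplicial_complex K /\
  exists M : topologicalType,
    closed_manifold R 2 M /\ homeomorphic (set_type (@realization R w K)) M.

Definition connected_complex (R : realType) (w : nat)
    (K : {set {set 'I_w}}) : Prop :=
  connected [set: set_type (@realization R w K)].

Definition labelled_surfaces (R : realType) (f w : nat) :
    {set {set {set 'I_w}}} :=
  [set K | `[< triangulated_surface R K /\ connected_complex R K >]
           && (#|two_faces K| == f)]%SET.

(* The isomorphism classes.  A complex with exactly w vertices is isomorphic
   to one with vertex set 'I_w, so it suffices to consider the latter. *)
Definition surface_classes (R : realType) (f w : nat) :
    {set {set {set {set 'I_w}}}} :=
  equivalence_partition (@simplicial_iso w) (@labelled_surfaces R f w).

(* Main.v *)
Require Import Defs.
From mathcomp Require Import all_boot all_fingroup all_order all_algebra.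
From mathcomp Require Import all_classical all_reals all_analysis.
From mathcomp Require Import zify ring lra.

Set Implicit Arguments.
Unset Strict Implicit.
Unset Printing Implicit Defensive.

Import Order.TTheory GRing.Theory Num.Theory.
Import numFieldNormedType.Exports.

Local Open Scope ring_scope.

(** Cut a surface with [f] triangles and [w] vertices along all its edges.  It is
    then described by [f] labelled triangles and a gluing, a pairing of their
    [3 f] sides.  There are about [f ^ (3 f / 2)] pairings up to a factor
    [C ^ f], and [f`!] labellings for each surface, which gives the factor
    [f ^ (f / 2)].  The number of vertices enters through a spanning tree of the
    1-skeleton: once the other edges have been glued, the gluing of its [w - 1]
    edges is forced, because at a leaf of the tree the two sides of its edge are
    the only ones left and must be glued to each other.  So one has to choose
    partners for [3 f / 2 - w + 1] sides only, and remember in addition a set of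
    flags, at the cost of [C ^ f].  This saves a factor [f ^ w], and [w <= 3 f],
    so the bound holds with exponent [- w], whatever [delta] is.

    Triangulated surfaces are given topologically, and the count uses that
    every edge is in exactly two triangles, that there is no face of higher
    dimension, and that links are connected.  The first two facts follow from
    invariance of domain in the plane ([invariance_of_domain_plane]): too few
    triangles on an edge would put a boundary point of a half plane inside an
    open set, and too many triangles, or a 3-simplex, would contain an embedded
    disc that is not open.  Links are connected because a punctured disc is
    ([punctured_sign]).  Invariance of domain itself rests on a parity argument
    on a square grid ([grid_crossing]), in the spirit of the lemma of Sperner.

    The counting part consists of [gluing_code_inj], which shows that the tree
    edges are forced, [gluing_count], and [classes_le_gluings], which divides by
    the number of labellings: since flags can be reached from each other, a
    gluing and the position of one triangle determine the labelling. *)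

(** * Sup norm and compactness *)

Section RowNorm.
Context {R : realType} {n : nat}.
Implicit Types (x : 'rV[R]_n) (r : R).

Lemma coord_le_norm x i : `|x ord0 i| <= `|x|.
Proof.
rewrite [leRHS]/Num.norm /= mx_normrE.
exact: (le_bigmax _ (fun ij : 'I_1 * 'I_n => `|x ij.1 ij.2|) (ord0, i)).
Qed.

Lemma norm_rV_le x r : 0 <= r -> (forall i, `|x ord0 i| <= r) -> `|x| <= r.
Proof.
move=> r0 xr; rewrite [leLHS]/Num.norm /= mx_normrE.
by apply/bigmax_leP; split=> // -[i j] _ /=; rewrite ord1.
Qed.

Lemma norm_rV_lt x r : 0 < r -> (forall i, `|x ord0 i| < r) -> `|x| < r.
Proof.
move=> r0 xr; rewrite [ltLHS]/Num.norm /= mx_normrE.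
by apply/bigmax_ltP; split=> // -[i j] _ /=; rewrite ord1.
Qed.

End RowNorm.

Lemma norm_rV_attained (R : realType) n (x : 'rV[R]_n.+1) :
  exists i, `|x ord0 i| = `|x|.
Proof.
have [x0|xn0] := eqVneq `|x| 0.
  by exists ord0; apply/eqP; rewrite eq_le coord_le_norm x0 normr_ge0.
have [[i j] /= ->] : exists i, `|x| = `|x i.1 i.2|.
  rewrite [X in exists _, X = _]/Num.norm /=.
  by apply: mx_norm_neq0.
by exists j => /=; rewrite (ord1 i).
Qed.

Lemma compact_unit_ball (R : realType) n :
  compact [set x : 'rV[R]_n | `|x| <= 1]%classic.
Proof.
apply: bounded_closed_compact.
  exists 1; split; first exact: num_real.
  by move=> M M1 x /= x1; apply: le_trans x1 (ltW M1).
have -> : [set x : 'rV[R]_n | `|x| <= 1]%classic = closed_ball_ Num.norm 0 1.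
  by apply/funext => x; rewrite /closed_ball_ /= sub0r normrN.
exact: closed_closed_ball_.
Qed.

(** The source of every uniform constant below: uniform continuity, uniform
    injectivity and a positive distance to a missed point are all instances. *)
Lemma compact_uniform (R : realType) (V : normedModType R) (K : set V)
    (P : V -> R -> Prop) :
  compact K ->
  (forall x (d e : R), 0 < e -> e <= d -> P x d -> P x e) ->
  (forall x, K x -> exists2 d : R, 0 < d &
     forall y, K y -> `|x - y| < d -> P y d) ->
  exists2 d : R, 0 < d & forall x, K x -> P x d.
Proof.
move=> /compact_near_coveringP/near_covering_withinP cK Pmono Ploc.
have /= Hd := cK R (0^'+)%classic (fun d x => P x d) _ _.
have {}Hd : (\forall d \near 0^'+, forall x, K x -> P x d)%classic.
  apply: Hd => x Kx; have [d d0 Pd] := Ploc x Kx.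
  exists (ball x d, [set e | 0 < e <= d]%classic) => /=.
    split; first exact: nbhsx_ballx.
    near=> e; apply/andP; split; near: e.
      exact: nbhs_right_gt.
    exact: nbhs_right_le.
  move=> [y e] /= [bxy /andP[e0 ed]] Ky.
  by apply: (Pmono y d) => //; apply: Pd => //; rewrite -ball_normE in bxy.
near ((0:R)^'+)%classic => d.
exists d; near: d; first exact: nbhs_right_gt.
exact: Hd.
Unshelve. all: by end_near. Qed.

(** * Invariance of domain in the plane *)

(** Call an edge of the grid marked if [b] holds at both ends and [a] changes
    along it.  A cell on which [a] or [b] is constant has evenly many marked
    sides; if every cell were of that kind, the parity of the number of marked
    edges would be the same on all horizontal lines, but it is even on the
    bottom line and odd on the top one. *)
Lemma grid_crossing (n : nat) (a b : nat -> nat -> bool) :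
  (forall j, (j <= n)%N -> a 0%N j = false) ->
  (forall j, (j <= n)%N -> a n j = true) ->
  (forall i, (i <= n)%N -> b i 0%N = false) ->
  (forall i, (i <= n)%N -> b i n = true) ->
  let const (c : nat -> nat -> bool) i j :=
    [&& c i j == c i.+1 j, c i j == c i j.+1 & c i j == c i.+1 j.+1] in
  exists i j, [/\ (i < n)%N, (j < n)%N, ~~ const a i j & ~~ const b i j].
Proof.
move=> a0 an b0 bn const; apply: contrapT => Hno.
have cell i j : (i < n)%N -> (j < n)%N -> const a i j || const b i j.
  move=> ilt jlt; apply/negPn/negP; rewrite negb_or => /andP[ca cb].
  by apply: Hno; exists i, j.
pose h i j := [&& b i j, b i.+1 j & a i j (+) a i.+1 j].
pose v i j := [&& b i j, b i j.+1 & a i j (+) a i j.+1].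
pose H m j := \big[addb/false]_(i < m) h i j.
have even_cell i j : (i < n)%N -> (j < n)%N ->
    h i j (+) h i j.+1 = v i j (+) v i.+1 j.
  move=> ilt jlt; have := cell i j ilt jlt; rewrite /const /h /v.
  move: (a i j) (a i.+1 j) (a i j.+1) (a i.+1 j.+1).
  move: (b i j) (b i.+1 j) (b i j.+1) (b i.+1 j.+1).
  by do 8!case.
have strip j m : (j < n)%N -> (m <= n)%N ->
    H m j (+) H m j.+1 = v 0%N j (+) v m j.
  move=> jn; elim: m => [_|m IHm mn]; first by rewrite /H !big_ord0 !addbb.
  rewrite /H !big_ord_recr /= addbACA -/(H m j) -/(H m j.+1) (IHm (ltnW mn)).
  by rewrite even_cell // addbA addbK.
have line j : (j <= n)%N -> H n j = false.
  elim: j => [_|j IHj jn].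
    by rewrite /H big1 // => i _; rewrite /h b0 // ltnW.
  have := strip j n jn (leqnn n); rewrite (IHj (ltnW jn)) /v.
  by rewrite !a0 ?(ltnW jn) // !an ?(ltnW jn) //= !andbF.
have tele m : (m <= n)%N -> H m n = a 0%N n (+) a m n.
  elim: m => [_|m IHm mn]; first by rewrite /H big_ord0 addbb.
  rewrite /H big_ord_recr /= -/(H m n) IHm 1?ltnW //.
  by rewrite /h !bn ?(ltnW mn) //= addbA addbK.
by have := tele n (leqnn n); rewrite line // a0 // an.
Qed.

Lemma ord2P (k : 'I_2) : k = ord0 \/ k = ord_max.
Proof. by case: k => [[|[|//]]] ?; [left|right]; apply: val_inj. Qed.

(** [grid_crossing] on a grid of mesh less than [tau]. *)
Lemma square_crossing (R : realType) (a b : 'rV[R]_2 -> bool) (tau : R) :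
  0 < tau ->
  (forall x : 'rV[R]_2, `|x| <= 1 -> x ord0 ord0 = -1 -> ~~ a x) ->
  (forall x : 'rV[R]_2, `|x| <= 1 -> x ord0 ord0 = 1 -> a x) ->
  (forall x : 'rV[R]_2, `|x| <= 1 -> x ord0 ord_max = -1 -> ~~ b x) ->
  (forall x : 'rV[R]_2, `|x| <= 1 -> x ord0 ord_max = 1 -> b x) ->
  exists p q r s, [/\ {in [:: p; q; r; s], forall x, `|x| <= 1},
    {in [:: p; q; r; s] &, forall x y, `|x - y| < tau},
    a p && ~~ a q & b r && ~~ b s].
Proof.
move=> tau0 aF aT bF bT.
have [N /andP[N0 Ntau]] : exists N : nat, (0 < N)%N && (2 / N%:R < tau).
  have := archi_boundP (_ : 0 <= 2 / tau); set n := Num.bound _.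
  rewrite divr_ge0 ?(ltW tau0) // => /(_ isT) hn.
  have n0 : (0 : R) < n%:R by apply: le_lt_trans hn; rewrite divr_ge0 ?ltW.
  exists n; rewrite -(ltr0n R) n0 /= ltr_pdivrMr // [tau * _]mulrC.
  by rewrite -ltr_pdivrMr.
have NR0 : (0 : R) < N%:R by rewrite ltr0n.
pose t i : R := 2 * i%:R / N%:R - 1.
pose g i j : 'rV[R]_2 := \row_k (if k == ord0 then t i else t j).
have t0 : t 0%N = -1 by rewrite /t mulr0 mul0r sub0r.
have tN : t N = 1 by rewrite /t mulfK ?gt_eqF //; lra.
have tb i : (i <= N)%N -> `|t i| <= 1.
  move=> iN; have : 0 <= (i%:R / N%:R : R) <= 1.
    by rewrite divr_ge0 //= ler_pdivrMr // mul1r ler_nat.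
  by rewrite /t ler_norml => /andP[? ?]; apply/andP; split; lra.
have gQ i j : (i <= N)%N -> (j <= N)%N -> `|g i j| <= 1.
  by move=> iN jN; apply: norm_rV_le => // k; rewrite mxE; case: ifP; auto.
have g0 i j : g i j ord0 ord0 = t i by rewrite mxE eqxx.
have g1 i j : g i j ord0 ord_max = t j by rewrite mxE.
have [||||i [j [iN jN ca cb]]] :=
    @grid_crossing N (fun i j => a (g i j)) (fun i j => b (g i j)).
- by move=> j jN; apply/negbTE/aF; [exact: gQ|rewrite g0 t0].
- by move=> j jN; apply/aT; [exact: gQ|rewrite g0 tN].
- by move=> i iN; apply/negbTE/bF; [exact: gQ|rewrite g1 t0].
- by move=> i iN; apply/bT; [exact: gQ|rewrite g1 tN].
pose cell := [:: g i j; g i.+1 j; g i j.+1; g i.+1 j.+1].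
have cellP x : x \in cell -> exists i' j',
    [/\ (i <= i' <= i.+1)%N, (j <= j' <= j.+1)%N & x = g i' j'].
  by rewrite !inE => /or4P[] /eqP ->;
    [exists i, j|exists i.+1, j|exists i, j.+1|exists i.+1, j.+1];
    split=> //; rewrite !leqnn ?leqnSn.
have cellQ x : x \in cell -> `|x| <= 1.
  by case/cellP => i' [j' [/andP[_ i'N] /andP[_ j'N] ->]]; apply: gQ;
    [apply: leq_trans i'N _|apply: leq_trans j'N _].
have tstep m i1 i2 : (m <= i1 <= m.+1)%N -> (m <= i2 <= m.+1)%N ->
    `|t i1 - t i2| <= 2 / N%:R.
  move=> i1m i2m.
  have -> : t i1 - t i2 = (i1%:R - i2%:R) * (2 / N%:R) by rewrite /t; lra.
  rewrite normrM (ger0_norm (_ : 0 <= 2 / _)) ?divr_ge0 //.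
  apply: ler_piMl; first by rewrite divr_ge0.
  have bnd k : (m <= k <= m.+1)%N -> (m%:R : R) <= (k%:R : R) <= m%:R + 1.
    by rewrite natr1 !ler_nat.
  by have := bnd _ i1m; have := bnd _ i2m; rewrite ler_norml; lra.
have cellclose x x' : x \in cell -> x' \in cell -> `|x - x'| < tau.
  case/cellP => i1 [j1 [i1b j1b ->]] /cellP[i2 [j2 [i2b j2b ->]]].
  apply: le_lt_trans Ntau; apply: norm_rV_le; first by rewrite divr_ge0.
  by move=> k; rewrite !mxE; case: ifP => _;
    [apply: tstep i1b i2b|apply: tstep j1b j2b].
have jumps (d : 'rV[R]_2 -> bool) :
    ~~ [&& d (g i j) == d (g i.+1 j), d (g i j) == d (g i j.+1)
         & d (g i j) == d (g i.+1 j.+1)] ->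
    exists x x', [/\ x \in cell, x' \in cell & d x && ~~ d x'].
  rewrite /cell => djump.
  have /hasP[x xin dx] : has d cell.
    apply: contraR djump => /hasPn nod.
    by do 4!rewrite (negbTE (nod _ _)) ?inE ?eqxx ?orbT //.
  have /hasP[x' x'in dx'] : has (predC d) cell.
    apply: contraR djump => /hasPn alld.
    have {}alld y : y \in cell -> d y by move=> /alld /negPn.
    by do 4!rewrite (alld _ _) ?inE ?eqxx ?orbT //.
  by exists x, x'; rewrite xin x'in dx.
have [p [q [pin qin apq]]] := jumps a ca.
have [r [s [rin sin brs]]] := jumps b cb.
exists p, q, r, s; split=> //.
  by move=> x; rewrite !inE => /or4P[] /eqP ->; auto.
by move=> x x'; rewrite !inE => /or4P[] /eqP -> /or4P[] /eqP ->; auto.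
Qed.

(** On the boundary of a square with integral corners, rounding down jumps at
    integers and rounding to nearest at half-integers; these are 1/2 apart on
    each side, and near a corner rounding to nearest is constant. *)
Lemma floor_round_square (R : realType) (L : nat) (p q r s : 'rV[R]_2) :
  (0 < L)%N ->
  (forall x, x \in [:: p; q; r; s] -> `|x| = L%:R) ->
  {in [:: p; q; r; s] &, forall x y, `|x - y| < 2^-1} ->
  (forall k, Num.floor (p ord0 k) = Num.floor (q ord0 k)) \/
  (forall k, Num.floor (r ord0 k + 2^-1) = Num.floor (s ord0 k + 2^-1)).
Proof.
move=> L0 normL close.
have L1 : (1 : R) <= L%:R by rewrite ler1n.
have inp : p \in [:: p; q; r; s] by rewrite !inE eqxx.
have inq : q \in [:: p; q; r; s] by rewrite !inE eqxx !orbT.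
have inr : r \in [:: p; q; r; s] by rewrite !inE eqxx !orbT.
have ins : s \in [:: p; q; r; s] by rewrite !inE eqxx !orbT.
have closek x y k : x \in [:: p; q; r; s] -> y \in [:: p; q; r; s] ->
    `|x ord0 k - y ord0 k| < 2^-1.
  move=> xin yin; have := close x y xin yin; apply: le_lt_trans.
  by have := coord_le_norm (x - y) k; rewrite !mxE.
pose on k := has (fun x : 'rV[R]_2 => `|x ord0 k| == L%:R) [:: p; q; r; s].
have round_on k : on k ->
    Num.floor (r ord0 k + 2^-1) = Num.floor (s ord0 k + 2^-1).
  case/hasP=> x xin /eqP xk.
  have [m xm] : exists m : int, x ord0 k = m%:~R.
    have [x0|x0] := ltP (x ord0 k) 0.
      exists (- (L%:Z)); rewrite mulrNz -[L%:~R]/(L%:R) -xk ltr0_norm //.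
      by rewrite opprK.
    by exists L%:Z; rewrite -[L%:~R]/(L%:R) -xk ger0_norm.
  have toM y : y \in [:: p; q; r; s] -> Num.floor (y ord0 k + 2^-1) = m.
    move=> yin; apply: floor_def; rewrite intrD -xm.
    by have := closek x y k xin yin; rewrite ltr_norml; lra.
  by rewrite !toM.
have notopp k x y : x \in [:: p; q; r; s] -> y \in [:: p; q; r; s] ->
    `|x ord0 k| = L%:R -> `|y ord0 k| = L%:R -> x ord0 k = y ord0 k.
  move=> xin yin; have := closek x y k xin yin; rewrite ltr_norml.
  by case: (ltP (x ord0 k) 0) => x0; case: (ltP (y ord0 k) 0) => y0;
    rewrite ?(ltr0_norm x0) ?(ltr0_norm y0) ?(ger0_norm x0) ?(ger0_norm y0); lra.
have onedim k : Num.floor (p ord0 k) = Num.floor (q ord0 k) \/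
    Num.floor (r ord0 k + 2^-1) = Num.floor (s ord0 k + 2^-1).
  have key x y z t : x \in [:: p; q; r; s] -> y \in [:: p; q; r; s] ->
      z \in [:: p; q; r; s] -> t \in [:: p; q; r; s] ->
      (Num.floor (x ord0 k) < Num.floor (y ord0 k))%R ->
      (Num.floor (z ord0 k + 2^-1) < Num.floor (t ord0 k + 2^-1))%R -> False.
    move=> xin yin zin tin.
    rewrite floor_lt_int => xy; rewrite floor_lt_int => zt.
    have ylo := floor_le (y ord0 k); have tlo := floor_le (t ord0 k + 2^-1).
    have := closek y z k yin zin; have := closek t x k tin xin.
    rewrite !ltr_norml.
    have [mn|nm] := leP (Num.floor (t ord0 k + 2^-1)) (Num.floor (y ord0 k)).
      by move: mn; rewrite -(ler_int R); lra.
    have : Num.floor (y ord0 k) + 1 <= Num.floor (t ord0 k + 2^-1).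
      by rewrite lezD1.
    by rewrite -(ler_int R) intrD; lra.
  case: (ltgtP (Num.floor (p ord0 k)) (Num.floor (q ord0 k))) => [pq|qp|->];
    last by left.
  - case: (ltgtP (Num.floor (r ord0 k + 2^-1)) (Num.floor (s ord0 k + 2^-1)))
      => [rs|sr|->]; last by right.
      by case: (key p q r s).
    by case: (key p q s r).
  - case: (ltgtP (Num.floor (r ord0 k + 2^-1)) (Num.floor (s ord0 k + 2^-1)))
      => [rs|sr|->]; last by right.
      by case: (key q p r s).
    by case: (key q p s r).
have two (k k' : 'I_2) : k != k' -> forall l, l = k \/ l = k'.
  by move=> kk' l; case: (ord2P k) (ord2P k') (ord2P l) kk'
    => -> [] -> [] -> //; auto.
have all_on k k' : k != k' -> ~~ on k' -> forall x, x \in [:: p; q; r; s] ->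
    `|x ord0 k| = L%:R.
  move=> kk' /hasPn offk' x xin; rewrite -(normL x xin).
  have [l xl] := norm_rV_attained x.
  case: (two _ _ kk' l) => lE; first by rewrite -lE.
  by have := offk' x xin; rewrite -lE xl normL // eqxx.
have finish k k' : k != k' -> ~~ on k' ->
  (forall k, Num.floor (p ord0 k) = Num.floor (q ord0 k)) \/
  (forall k, Num.floor (r ord0 k + 2^-1) = Num.floor (s ord0 k + 2^-1)).
  move=> kk' off; have aon := all_on k k' kk' off.
  have pqk : p ord0 k = q ord0 k by apply: notopp; rewrite ?aon.
  have rsk : r ord0 k = s ord0 k by apply: notopp; rewrite ?aon.
  case: (onedim k') => E; [left|right] => l;
    by case: (two _ _ kk' l) => ->; rewrite ?pqk ?rsk.
have [on0|off0] := boolP (on ord0); last exact: (finish ord_max ord0).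
have [on1|off1] := boolP (on ord_max); last exact: (finish ord0 ord_max).
right=> k; apply: round_on; case: (ord2P k) => ->.
  exact: on0.
exact: on1.
Qed.

Definition cont_on (R : realType) (V W : normedModType R) (A : set V)
    (f : V -> W) : Prop :=
  forall x, A x -> forall e : R, 0 < e ->
    exists2 d : R, 0 < d & forall y, A y -> `|x - y| < d -> `|f x - f y| < e.

Section Uniformity.
Context {R : realType} {V W : normedModType R} (A : set V) (f : V -> W).
Hypotheses (cA : compact A) (cf : cont_on A f).

Lemma unif_cont_on e : 0 < e ->
  exists2 d : R, 0 < d &
    forall x y, A x -> A y -> `|x - y| < d -> `|f x - f y| < e.
Proof.
move=> e0; pose P x d := forall y, A y -> `|x - y| < d -> `|f x - f y| < e.
have [||d d0 Pd] := @compact_uniform R V A P cA.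
- by move=> x d d' _ d'd Px y Ay xy; apply: Px => //; apply: lt_le_trans xy _.
- move=> x Ax; have [d d0 fd] := cf Ax (divr_gt0 e0 (ltr0Sn R 1)).
  exists (d / 2); first by rewrite divr_gt0.
  move=> y Ay xy z Az yz.
  have fxy : `|f x - f y| < e / 2 by apply: fd => //; lra.
  have fxz : `|f x - f z| < e / 2.
    by apply: fd => //; have := ler_distD y x z; lra.
  by have := ler_distD (f x) (f y) (f z); rewrite (distrC (f y) (f x)); lra.
by exists d => // x y Ax; apply: Pd.
Qed.

Lemma dist_away c : (forall x, A x -> f x <> c) ->
  exists2 d : R, 0 < d & forall x, A x -> d <= `|f x - c|.
Proof.
move=> fc; apply: (@compact_uniform R V A (fun x d => d <= `|f x - c|)) => //.
- by move=> x d e _ ed; apply: le_trans.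
- move=> x Ax; have m0 : 0 < `|f x - c|.
    by rewrite normr_gt0 subr_eq0; apply/eqP/fc.
  have [d d0 fd] := cf Ax (divr_gt0 m0 (ltr0Sn R 1)).
  exists (Num.min d (`|f x - c| / 2)).
    by rewrite lt_min d0 divr_gt0.
  move=> y Ay; rewrite lt_min => /andP[xy _].
  have := fd y Ay xy; have := ler_distD (f y) (f x) c.
  by rewrite ge_min => ? ?; apply/orP; right; lra.
Qed.

Lemma unif_inj_on e : 0 < e ->
  (forall x y, A x -> A y -> f x = f y -> x = y) ->
  exists2 d : R, 0 < d &
    forall x y, A x -> A y -> `|f x - f y| < d -> `|x - y| < e.
Proof.
move=> e0 injf.
pose P x d := forall y, A y -> `|f x - f y| < d -> `|x - y| < e.
have [||d d0 Pd] := @compact_uniform R V A P cA.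
- by move=> x d d' _ d'd Px y Ay xy; apply: Px => //; apply: lt_le_trans xy _.
- move=> x Ax.
  have [d d0 xd] : exists2 d : R, 0 < d &
      forall y, A y -> `|f x - f y| < d -> `|x - y| < e / 2.
    apply: (@compact_uniform R V A
      (fun y d => `|f x - f y| < d -> `|x - y| < e / 2)) => //.
      by move=> y d d' _ d'd Py yd'; apply: Py; apply: lt_le_trans yd' _.
    move=> y Ay; have [fxy|fxy] := eqVneq (f x) (f y).
      have -> : y = x by apply: injf.
      by exists (e / 2); [rewrite divr_gt0|move=> z _ xz _].
    have m0 : 0 < `|f x - f y| / 2 by rewrite divr_gt0 // normr_gt0 subr_eq0.
    have [d d0 fd] := cf Ay m0.
    exists (Num.min d (`|f x - f y| / 2)); first by rewrite lt_min d0.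
    move=> z Az; rewrite !lt_min => /andP[yz _] /andP[_ xz].
    have := fd z Az yz; have := ler_distD (f z) (f x) (f y).
    by rewrite (distrC (f z) (f y)); lra.
  have d20 : 0 < d / 2 by rewrite divr_gt0.
  have [d' d'0 fd'] := cf Ax d20.
  exists (Num.min (d / 2) (Num.min d' (e / 2))).
    by rewrite !lt_min d20 d'0 divr_gt0.
  move=> y Ay; rewrite !lt_min => /and3P[_ xyd' xye] z Az.
  rewrite lt_min => /andP[yz _].
  have fxz : `|f x - f z| < d.
    by have := ler_distD (f y) (f x) (f z); have := fd' y Ay xyd'; lra.
  have := xd z Az fxz; have := ler_distD x y z; rewrite (distrC y x); lra.
by exists d => // x y Ax; apply: Pd.
Qed.

End Uniformity.

Lemma radial_close (R : realType) (V : normedModType R) (x x' : V) (e : R) :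
  0 <= e -> 0 < `|x| -> 0 < `|x'| ->
  `|(e / `|x|) *: x - (e / `|x'|) *: x'| <= 2 * e * `|x - x'| / `|x|.
Proof.
move=> e0 x0 x'0.
have -> : (e / `|x|) *: x - (e / `|x'|) *: x' = (e / `|x|) *:
    ((x - x') + ((`|x'| - `|x|) / `|x'|) *: x').
  rewrite scalerDr scalerA scalerBr -addrA -scaleNr -scaleNr -scalerDl.
  by congr (_ + _ *: _); field; rewrite !gt_eqF.
rewrite normrZ ger0_norm ?divr_ge0 // mulrAC [2 * e]mulrC -!mulrA.
apply: ler_wpM2l => //; rewrite [leRHS]mulrA; apply: ler_wpM2r.
  by rewrite invr_ge0.
apply: le_trans (ler_normD _ _) _.
rewrite normrZ normrM normfV normr_id mulfVK ?gt_eqF //.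
by have := ler_dist_dist x' x; rewrite (distrC x' x); lra.
Qed.

Lemma coord_gtN (R : realType) n (x y : 'rV[R]_n) k (e : R) :
  `|x - y| < e -> 0 <= x ord0 k -> - e < y ord0 k.
Proof.
by move=> xy; have := le_lt_trans (coord_le_norm _ k) xy; rewrite !mxE ltr_norml; lra.
Qed.

Lemma coord_lt (R : realType) n (x y : 'rV[R]_n) k (e : R) :
  `|x - y| < e -> x ord0 k < 0 -> y ord0 k < e.
Proof.
by move=> xy; have := le_lt_trans (coord_le_norm _ k) xy; rewrite !mxE ltr_norml; lra.
Qed.

Lemma coord_lt1 (R : realType) n (x y : 'rV[R]_n) k :
  `|x - y| < 1 -> (y ord0 k = -1 -> x ord0 k < 0) /\ (y ord0 k = 1 -> 0 <= x ord0 k).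
Proof.
move=> xy; have := le_lt_trans (coord_le_norm _ k) xy.
by rewrite !mxE ltr_norml => ?; split=> yk; lra.
Qed.

(** Why a map [f] that is continuous and injective on the unit square covers a
    neighbourhood of the image of the centre.  Suppose not, and let
    [c] be a missed value close to [f 0].  Push [f x - c] radially out of the
    square of radius [eps] around [0], cut the plane along a fine lattice in
    which this square is a union of cells, and read off the signs of the two
    coordinates of a preimage of a nearby value: the first coordinate after
    rounding down to the lattice, the second one after rounding to the nearest
    lattice point.  Off the small square the sampled preimages are close to
    the point itself, so the signs never both change at nearby points, since
    this would force the point to be near the origin.  On the small square they
    do not both change because the two roundings jump at different places.
    This contradicts [grid_crossing]. *)
Section InvarianceOfDomain.
Context {R : realType} (f : 'rV[R]_2 -> 'rV[R]_2).
Let Q : set 'rV[R]_2 := [set x | `|x| <= 1]%classic.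
Hypotheses (cf : cont_on Q f)
           (injf : forall x y, Q x -> Q y -> f x = f y -> x = y).

Section Missed.
Context (c : 'rV[R]_2) (eps : R).
Hypotheses (eps0 : 0 < eps) (f0c : `|f 0 - c| < eps)
  (far : forall x, Q x -> 2^-1 <= `|x| -> eps <= `|f x - c|)
  (fc : forall x, Q x -> f x <> c).

Let cQ : compact Q := @compact_unit_ball R 2.

Lemma no_missed_value : False.
Proof.
have Q0 : Q 0 by rewrite /Q /= normr0.
have [del del0 near0] : exists2 del : R, 0 < del &
    forall x, Q x -> eps <= `|f x - c| -> del <= `|x|.
  have d0 : 0 < eps - `|f 0 - c| by rewrite subr_gt0.
  have [d d'0 fd] := cf Q0 d0; exists d => // x Qx xe.
  rewrite leNgt; apply/negP => xd; have := fd x Qx.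
  rewrite sub0r normrN => /(_ xd); rewrite distrC.
  by have := ler_distD (f 0) (f x) c; lra.
pose eta := Num.min (del / 2) (4^-1).
have eta0 : 0 < eta by rewrite lt_min divr_gt0 //=; lra.
have eta_del : eta < del by rewrite gt_min; apply/orP; left; lra.
have eta_lt1 : eta < 1 by rewrite gt_min; apply/orP; right; lra.
have [h h0 injh] := unif_inj_on cQ cf eta0 injf.
(* A sample is within 3 lam of a lattice point that is within 2 lam of the image
   of the point it approximates. *)
have [L /andP[L0 Lh]] : exists L : nat, (0 < L)%N && (5 * eps / L%:R < h).
  have := archi_boundP (_ : 0 <= 5 * eps / h); set n := Num.bound _.
  rewrite divr_ge0 ?mulr_ge0 ?(ltW eps0) ?(ltW h0) // => /(_ isT) hn.
  have n0 : (0 : R) < n%:R by apply: le_lt_trans hn; rewrite divr_ge0 ?mulr_ge0 ?ltW.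
  exists n; rewrite -(ltr0n R) n0 /= ltr_pdivrMr // [h * _]mulrC -ltr_pdivrMr //.
have LR0 : (0 : R) < L%:R by rewrite ltr0n.
pose lam := eps / L%:R.
have lam0 : 0 < lam by rewrite divr_gt0.
have lam5 : 5 * lam < h by rewrite /lam mulrA.
have epsE : eps = lam * L%:R by rewrite /lam mulfVK // gt_eqF.
have [mu mu0 fmu] := dist_away cQ cf fc.
(* If two images are closer than kap, then so close are their radial projections
   that only one of the two roundings can jump between them. *)
pose kap := Num.min (lam / 8) (lam * mu / (8 * eps)).
have kap0 : 0 < kap.
  by rewrite lt_min; apply/andP; split; apply: divr_gt0 => //; apply: mulr_gt0.
have kap_lam : kap <= lam / 8 by rewrite ge_min lexx.
have kap_mu : 2 * eps * kap / mu < lam / 2.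
  have : kap <= lam * mu / (8 * eps) by rewrite ge_min lexx orbT.
  rewrite ler_pdivlMr ?mulr_gt0 // => km.
  by rewrite ltr_pdivrMr //; have := mulr_gt0 lam0 mu0; lra.
have [tau tau0 ftau] := unif_cont_on cQ cf kap0.
pose y (x : 'rV[R]_2) : 'rV[R]_2 := f x - c.
pose z (x : 'rV[R]_2) : 'rV[R]_2 := if eps <= `|y x| then y x else (eps / `|y x|) *: y x.
pose sample (p : 'rV[R]_2) : 'rV[R]_2 := xget (0 : 'rV[R]_2)
  [set x | [/\ Q x, eps <= `|y x| & `|y x - p| <= 3 * lam]]%classic.
pose A x : 'rV[R]_2 :=
  \row_k (lam * (Num.floor (z x ord0 k / lam))%:~R).
pose B x : 'rV[R]_2 :=
  \row_k (lam * (Num.floor (z x ord0 k / lam + 2^-1))%:~R).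
pose a x := 0 <= sample (A x) ord0 ord0.
pose b x := 0 <= sample (B x) ord0 ord_max.
have zA x : `|z x - A x| <= lam.
  apply: norm_rV_le => [|k]; first exact: ltW.
  rewrite !mxE; have /andP[] := floor_itv (z x ord0 k / lam).
  rewrite intrD ler_pdivlMr // ltr_pdivrMr // => ? ?.
  by rewrite ger0_norm; lra.
have zB x : `|z x - B x| <= lam.
  apply: norm_rV_le => [|k]; first exact: ltW.
  rewrite !mxE; have /andP[] := floor_itv (z x ord0 k / lam + 2^-1).
  rewrite -lerBlDr -ltrBrDr ler_pdivlMr // ltr_pdivrMr // intrD => ? ?.
  by rewrite ler_norml; lra.
have sampleP x0 x p : Q x0 -> eps <= `|y x0| -> `|z x - y x0| < lam ->
    `|z x - p| <= lam -> Q (sample p) /\ `|sample p - x0| < eta.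
  move=> Qx0 yx0 zx zp.
  have yp : `|y x0 - p| <= 2 * lam.
    by have := ler_distD (z x) (y x0) p; rewrite (distrC (y x0) (z x)); lra.
  have /= [Qs _ ys] : [set x | [/\ Q x, eps <= `|y x| & `|y x - p| <= 3 * lam]]%classic
      (sample p).
    by apply: xgetPex; exists x0; split=> //; lra.
  split=> //; apply: injh => //.
  have := ler_distD p (y (sample p)) (y x0); rewrite (distrC p (y x0)).
  have -> : y (sample p) - y x0 = f (sample p) - f x0.
    by rewrite /y opprB addrA subrK.
  by lra.
have yy x x' : y x - y x' = f x - f x' by rewrite /y opprB addrA subrK.
(* So where a coordinate of x is 1 or -1, that of the sample has its sign, and
   a and b satisfy the boundary conditions of square_crossing. *)
have edge x : Q x -> 2^-1 <= `|x| ->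
    `|sample (A x) - x| < 1 /\ `|sample (B x) - x| < 1.
  move=> Qx x1; have yx := far Qx x1.
  have zx : `|z x - y x| < lam by rewrite /z yx subrr normr0.
  have [_ sA] := sampleP x x _ Qx yx zx (zA x).
  have [_ sB] := sampleP x x _ Qx yx zx (zB x).
  by split; [exact: lt_trans sA eta_lt1|exact: lt_trans sB eta_lt1].
have nojump p q r s : {in [:: p; q; r; s], forall x, Q x} ->
    {in [:: p; q; r; s] &, forall x x', `|x - x'| < tau} ->
    a p -> ~~ a q -> b r -> ~~ b s -> False.
  move=> inQ close ap aq br bs.
  have fclose x x' : x \in [:: p; q; r; s] -> x' \in [:: p; q; r; s] ->
      `|y x - y x'| < kap.
    by move=> xin x'in; rewrite yy; apply: ftau; auto.
  have inp : p \in [:: p; q; r; s] by rewrite !inE eqxx.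
  have inq : q \in [:: p; q; r; s] by rewrite !inE eqxx !orbT.
  have inr : r \in [:: p; q; r; s] by rewrite !inE eqxx !orbT.
  have ins : s \in [:: p; q; r; s] by rewrite !inE eqxx !orbT.
  have [/hasP[x0 x0in yx0]|/hasPn allin] :=
      boolP (has (fun x => eps <= `|y x|) [:: p; q; r; s]).
    have Qx0 := inQ x0 x0in.
    have zx x : x \in [:: p; q; r; s] -> `|z x - y x0| < lam.
      move=> xin; have xx0 := fclose x x0 xin x0in; rewrite /z.
      case: ifPn => [_|]; first by lra.
      rewrite -ltNge => yx.
      have yxn0 : 0 < `|y x| by apply: lt_le_trans (fmu x (inQ x xin)).
      have -> : eps / `|y x| *: y x - y x0
              = (eps / `|y x| - 1) *: y x + (y x - y x0).
        by rewrite scalerBl scale1r addrA subrK.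
      have := ler_normD ((eps / `|y x| - 1) *: y x) (y x - y x0).
      rewrite normrZ ger0_norm; last first.
        by rewrite subr_ge0 ler_pdivlMr // mul1r ltW.
      rewrite mulrBl mul1r mulfVK ?gt_eqF //.
      have := ler_distD (y x) (y x0) 0; rewrite !subr0 (distrC (y x0)).
      by lra.
    have s1 x : x \in [:: p; q; r; s] -> `|sample (A x) - x0| < eta.
      by move=> xin; case: (sampleP x0 x (A x)); auto.
    have s2 x : x \in [:: p; q; r; s] -> `|sample (B x) - x0| < eta.
      by move=> xin; case: (sampleP x0 x (B x)); auto.
    have : `|x0| < del.
      apply: le_lt_trans eta_del; apply: norm_rV_le => [|k]; first exact: ltW.
      rewrite ler_norml; case: (ord2P k) => ->; apply/andP; split; apply: ltW.
      - exact: coord_gtN (s1 p inp) ap.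
      - by apply: coord_lt (s1 q inq) _; rewrite ltNge.
      - exact: coord_gtN (s2 r inr) br.
      - by apply: coord_lt (s2 s ins) _; rewrite ltNge.
    by apply/negP; rewrite -leNgt; apply: near0.
  have yeps x : x \in [:: p; q; r; s] -> `|y x| < eps.
    by move=> xin; rewrite ltNge; apply: allin.
  have ygt0 x : x \in [:: p; q; r; s] -> mu <= `|y x|.
    by move=> xin; apply: fmu; apply: inQ.
  have zE x : x \in [:: p; q; r; s] -> z x = (eps / `|y x|) *: y x.
    by move=> xin; rewrite /z leNgt (yeps x xin).
  pose u x := lam^-1 *: z x.
  have := @floor_round_square R L (u p) (u q) (u r) (u s) L0.
  rewrite -/(map u [:: p; q; r; s]).
  case.
  - move=> _ /mapP[x xin ->]; have m0 := lt_le_trans mu0 (ygt0 x xin).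
    rewrite /u zE // normrZ normrZ gtr0_norm ?invr_gt0 // gtr0_norm ?divr_gt0 //.
    by rewrite mulfVK ?gt_eqF // epsE mulKf // gt_eqF.
  - move=> _ _ /mapP[x xin ->] /mapP[x' x'in ->].
    have m0 := lt_le_trans mu0 (ygt0 x xin).
    have m'0 := lt_le_trans mu0 (ygt0 x' x'in).
    rewrite /u -scalerBr normrZ gtr0_norm ?invr_gt0 //.
    rewrite mulrC ltr_pdivrMr // mulrC.
    apply: le_lt_trans kap_mu.
    have xx' := fclose x x' xin x'in.
    rewrite !zE //; apply: le_trans (radial_close (ltW eps0) m0 m'0) _.
    apply: ler_pM.
    - by rewrite mulr_ge0 // mulr_ge0 // ltW.
    - by rewrite invr_ge0 ltW.
    - by rewrite ler_pM2l ?mulr_gt0 // ltW.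
    by rewrite lef_pV2 ?posrE //; apply: ygt0.
  - move=> pq; move: aq; apply/negP; rewrite negbK /a.
    suff -> : A q = A p by [].
    by apply/rowP => k; rewrite !mxE; have := pq k; rewrite !mxE !(mulrC lam^-1) => ->.
  - move=> rs; move: bs; apply/negP; rewrite negbK /b.
    suff -> : B s = B r by [].
    by apply/rowP => k; rewrite !mxE; have := rs k; rewrite !mxE !(mulrC lam^-1) => ->.
have corner x k : Q x -> `|x ord0 k| = 1 -> 2^-1 <= `|x|.
  by move=> _ xk; have := coord_le_norm x k; rewrite xk; apply: le_trans; lra.
have [||||p [q [r [s [inQ close /andP[ap aq] /andP[br bs]]]]]] :=
    @square_crossing R a b tau tau0.
- move=> x Qx xk; rewrite /a -ltNge.
  have [|sA _] := edge x Qx; first by apply: (corner x ord0); rewrite // xk normrN1.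
  by have [+ _] := coord_lt1 ord0 sA; apply.
- move=> x Qx xk; rewrite /a.
  have [|sA _] := edge x Qx; first by apply: (corner x ord0); rewrite // xk normr1.
  by have [_ +] := coord_lt1 ord0 sA; apply.
- move=> x Qx xk; rewrite /b -ltNge.
  have [|_ sB] := edge x Qx; first by apply: (corner x ord_max); rewrite // xk normrN1.
  by have [+ _] := coord_lt1 ord_max sB; apply.
- move=> x Qx xk; rewrite /b.
  have [|_ sB] := edge x Qx; first by apply: (corner x ord_max); rewrite // xk normr1.
  by have [_ +] := coord_lt1 ord_max sB; apply.
exact: (nojump p q r s).
Qed.

End Missed.

Theorem invariance_of_domain_plane :
  exists2 e : R, 0 < e & forall c, `|f 0 - c| < e -> exists2 x, Q x & f x = c.
Proof.
have h20 : (0 : R) < 2^-1 by rewrite invr_gt0.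
have Q0 : Q 0 by rewrite /Q /= normr0.
have [h h0 injh] := unif_inj_on (@compact_unit_ball R 2) cf h20 injf.
exists (h / 2); first by rewrite divr_gt0.
move=> c f0c; apply: contrapT => noc.
apply: (@no_missed_value c (h / 2)) => //; first by rewrite divr_gt0.
  move=> x Qx; rewrite leNgt => /negP x1; rewrite leNgt; apply/negP => xc.
  apply: x1; have := injh x 0 Qx Q0; rewrite subr0; apply.
  by have := ler_distD c (f x) (f 0); rewrite (distrC c (f 0)); lra.
by move=> x Qx fxc; apply: noc; exists x.
Qed.

End InvarianceOfDomain.

(** * Charts of a triangulated surface *)

Lemma insubd_continuous_at (T : topologicalType) (A : set T) (a0 : A) (m : T) :
  open A -> A m -> {for m, continuous (insubd a0 : T -> A)}.
Proof.
move=> oA Am N /= [_ /= [[W oW <-]] /= Wm WN].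
have Wm' : W m.
  by move: Wm; rewrite /= set_valE /= insubdK //; apply: mem_set.
have : nbhs m (A `&` W)%classic.
  by apply: open_nbhs_nbhs; split; [exact: openI|].
apply: filterS => y [Ay Wy]; apply: WN => /=.
by rewrite set_valE /= insubdK //; apply: mem_set.
Qed.

Lemma subtype_continuous_eps (R : realType) (V W : normedModType R) (A : set V)
    (g : A -> W) (x : A) :
  {for x, continuous g} -> forall e : R, 0 < e ->
  exists2 d : R, 0 < d &
    forall y : A, `|\val x - \val y| < d -> `|g x - g y| < e.
Proof.
move=> cg e e0; have := cg _ (nbhsx_ballx (g x) e e0).
move=> /= [_ /= [[U oU <-]] /= Ux UN].
have : nbhs (\val x) U by apply: open_nbhs_nbhs; split.
move=> /nbhs_ballP[d /= d0 dU]; exists d => // y xy.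
have : ball (g x) e (g y).
  by apply: UN => /=; apply: dU; rewrite -ball_normE.
by rewrite -ball_normE.
Qed.

Lemma normed_continuous_eps (R : realType) (V W : normedModType R)
    (g : V -> W) (x : V) :
  {for x, continuous g} -> forall e : R, 0 < e ->
  exists2 d : R, 0 < d & forall y, `|x - y| < d -> `|g x - g y| < e.
Proof.
move=> cg e e0; have := cg _ (nbhsx_ballx (g x) e e0).
move=> /nbhs_ballP[d /= d0 dN]; exists d => // y xy.
by have := dN y; rewrite -!ball_normE; apply.
Qed.

Lemma set_val_continuous (T : topologicalType) (A : set T) :
  continuous (\val : A -> T).
Proof. exact: initial_continuous. Qed.

(** [phi] and [psi] are defined everywhere but only meaningful near [p] and
    [phi p]; this avoids maps between subspaces. *)
Definition is_chart (R : realType) (w : nat) (X : set 'rV[R]_w) (p : 'rV[R]_w)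
    (phi : 'rV[R]_w -> 'rV[R]_2) (psi : 'rV[R]_2 -> 'rV[R]_w) (r e : R) :=
  [/\ forall z, `|phi p - z| < r -> X (psi z) /\ phi (psi z) = z,
      forall x, X x -> `|p - x| < e -> `|phi p - phi x| < r /\ psi (phi x) = x,
      cont_on (fun x => X x /\ `|p - x| < e) phi &
      cont_on (fun z => `|phi p - z| < r) psi].

Lemma surface_chart (R : realType) (w : nat) (K : {set {set 'I_w}})
    (p : 'rV[R]_w) :
  triangulated_surface R K -> @realization R w K p ->
  exists phi psi (r e : R), [/\ 0 < r, 0 < e
    & is_chart (@realization R w K) p phi psi r e].
Proof.
set X := @realization R w K.
move=> [_ [M [[_ _ leM _]]]] [h [k [hK kK hc kc]]] Xp.
pose p' : X := exist _ p (mem_set Xp).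
have [U [V [oU Up oV [h2 [k2 [h2K k2K h2c k2c]]]]]] := leM (h p').
pose u0 : U := exist _ (h p') (mem_set Up).
pose v0 : V := h2 u0.
pose f1 (x : X) : 'rV[R]_2 := \val (h2 (insubd u0 (h x))).
pose phi x := f1 (insubd p' x).
pose psi z : 'rV[R]_w := \val (k (\val (k2 (insubd v0 z)))).
have inX x : X x -> \val (insubd p' x) = x.
  by move=> Xx; rewrite insubdK //; apply: mem_set.
have inU m : U m -> \val (insubd u0 m) = m.
  by move=> Um; rewrite insubdK //; apply: mem_set.
have inV z : V z -> \val (insubd v0 z) = z.
  by move=> Vz; rewrite insubdK //; apply: mem_set.
have f1c (x : X) : U (h x) -> {for x, continuous f1}.
  move=> Uhx; apply: (@continuous_comp _ _ _ h
    (fun m => \val (h2 (insubd u0 m)))); first exact: hc.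
  apply: (@continuous_comp M U 'rV[R]_2 (insubd u0) (fun m => \val (h2 m))).
    exact: insubd_continuous_at.
  apply: (@continuous_comp U V 'rV[R]_2 h2 \val); first exact: h2c.
  exact: set_val_continuous.
have psic z : V z -> {for z, continuous psi}.
  move=> Vz; apply: (@continuous_comp 'rV[R]_2 V 'rV[R]_w (insubd v0)
    (fun z => \val (k (\val (k2 z))))); first exact: insubd_continuous_at.
  apply: (@continuous_comp V U 'rV[R]_w k2 (fun z => \val (k (\val z)))).
    exact: k2c.
  apply: (@continuous_comp U M 'rV[R]_w \val (fun z => \val (k z))).
    exact: set_val_continuous.
  apply: (@continuous_comp M X 'rV[R]_w k \val); first exact: kc.
  exact: set_val_continuous.
have p'E : insubd p' p = p' by apply: val_inj; rewrite inX.
have Vp : V (phi p) by rewrite /phi /f1; apply: set_valP.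
have [r /= r0 rV] : exists2 r : R, 0 < r &
    forall z, `|phi p - z| < r -> V z.
  have : nbhs (phi p) V by apply: open_nbhs_nbhs.
  move=> /nbhs_ballP[r /= r0 rV]; exists r => // z pz.
  by apply: rV; rewrite -ball_normE.
have [e1 e10 e1U] : exists2 e1 : R, 0 < e1 &
    forall x : X, `|p - \val x| < e1 -> U (h x).
  have : nbhs p' (h @^-1` U)%classic.
    by apply: hc; apply: open_nbhs_nbhs; split.
  move=> /= [_ /= [[W oW <-]] /= Wp WU].
  have : nbhs p W by apply: open_nbhs_nbhs; split.
  move=> /nbhs_ballP[d /= d0 dW]; exists d => // x px.
  by apply: WU => /=; apply: dW; rewrite -ball_normE.
have Up' : U (h p') by [].
have [e2 e20 e2r] := subtype_continuous_eps (f1c p' Up') r0.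
exists phi, psi, r, (Num.min e1 e2); split=> //; first by rewrite lt_min e10.
split.
- move=> z pz; have Vz := rV z pz; split; first exact: set_valP.
  by rewrite /phi /psi valKd /f1 kK valKd k2K inV.
- move=> x Xx; rewrite lt_min => /andP[pe1 pe2].
  have Uhx : U (h (insubd p' x)) by apply: e1U; rewrite inX.
  split; first by rewrite /phi p'E; apply: e2r; rewrite /= inX.
  by rewrite /psi /phi /f1 valKd h2K inU // hK inX.
- move=> x [Xx]; rewrite lt_min => /andP[pe1 pe2] d d0.
  have Uhx : U (h (insubd p' x)) by apply: e1U; rewrite inX.
  have [d' d'0 H] := subtype_continuous_eps (f1c _ Uhx) d0.
  exists d' => // y [Xy _] xy; apply: H.
  by rewrite !inX.
- move=> z pz d d0; have Vz := rV z pz.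
  have [d' d'0 H] := normed_continuous_eps (psic _ Vz) d0.
  by exists d' => // y _ zy; apply: H.
Qed.

(** * Local consequences of invariance of domain *)

Lemma lipschitz_cont_on (R : realType) (V W : normedModType R) (A : set V)
    (f : V -> W) (L : R) :
  0 < L -> (forall x y, `|f x - f y| <= L * `|x - y|) -> cont_on A f.
Proof.
move=> L0 Lf x _ e e0; exists (e / L); first by rewrite divr_gt0.
move=> y _ xy; apply: le_lt_trans (Lf x y) _.
by rewrite mulrC -ltr_pdivlMr.
Qed.

Section Local.
Context {R : realType} {w : nat} (K : {set {set 'I_w}}).
Hypothesis surfK : triangulated_surface R K.
Local Notation X := (@realization R w K).

(** Invariance of domain for [q] followed by a chart at the centre. *)
Lemma disc_nbhd (q : 'rV[R]_2 -> 'rV[R]_w) :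
  let Q := [set t : 'rV[R]_2 | `|t| <= 1]%classic in
  cont_on Q q -> (forall s t, Q s -> Q t -> q s = q t -> s = t) ->
  (forall t, Q t -> X (q t)) ->
  exists2 e : R, 0 < e &
    forall x, X x -> `|q 0 - x| < e -> exists2 t, Q t & q t = x.
Proof.
move=> Q cq injq qX; have Q0 : Q 0 by rewrite /Q /= normr0.
have [phi [psi [r [e [r0 e0 [_ phiX cphi _]]]]]] := surface_chart surfK (qX 0 Q0).
have [d d0 qd] := cq 0 Q0 e e0.
pose s := Num.min (d / 2) 1.
have s0 : 0 < s by rewrite lt_min divr_gt0 //= ltr01.
have sd : s < d by rewrite gt_min; apply/orP; left; lra.
have s1 : s <= 1 by rewrite ge_min lexx orbT.
have Qs t : Q t -> Q (s *: t).
  move=> t1; rewrite /Q /= normrZ gtr0_norm //.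
  by apply: le_trans s1; rewrite ger_pMr.
have near t : Q t -> `|q 0 - q (s *: t)| < e.
  move=> Qt; apply: qd; first exact: Qs.
  rewrite sub0r normrN normrZ gtr0_norm //; apply: le_lt_trans sd.
  by rewrite ger_pMr.
have dom t : Q t -> X (q (s *: t)) /\ `|q 0 - q (s *: t)| < e.
  by move=> Qt; split; [apply/qX/Qs|apply: near].
pose f t := phi (q (s *: t)).
have cf : cont_on Q f.
  move=> t Qt e1 e10; have [d1 d10 phid] := cphi _ (dom t Qt) e1 e10.
  have [d2 d20 qd2] := cq _ (Qs t Qt) d1 d10.
  exists d2 => // t' Qt' tt'; apply: phid; first exact: dom.
  apply: qd2; first exact: Qs.
  rewrite -scalerBr normrZ gtr0_norm //; apply: le_lt_trans tt'.
  exact: ler_piMl.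
have injf t t' : Q t -> Q t' -> f t = f t' -> t = t'.
  move=> Qt Qt' ff; have [Xt nt] := dom t Qt; have [Xt' nt'] := dom t' Qt'.
  have : s *: t = s *: t'.
    apply: injq; [exact: Qs|exact: Qs|].
    by rewrite -(phiX _ Xt nt).2 -(phiX _ Xt' nt').2; congr psi.
  by apply: scalerI; rewrite gt_eqF.
have [e1 e10 cover] := invariance_of_domain_plane cf injf.
have p0 : X (q 0) /\ `|q 0 - q 0| < e by rewrite subrr normr0; split; auto.
have [d1 d10 phid] := cphi _ p0 e1 e10.
exists (Num.min d1 e); first by rewrite lt_min d10.
move=> x Xx; rewrite lt_min => /andP[xd1 xe].
have [|t Qt ft] := cover (phi x).
  by rewrite /f scaler0; apply: phid.
exists (s *: t); first exact: Qs.
have [Xt nt] := dom t Qt.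
by rewrite -(phiX _ Xt nt).2 -(phiX _ Xx xe).2 -ft.
Qed.

(** Invariance of domain for the inverse of a chart at [p] followed by [j]. *)
Lemma planar_nbhd (p : 'rV[R]_w) (j : 'rV[R]_w -> 'rV[R]_2) (e : R) :
  X p -> 0 < e -> cont_on X j ->
  (forall x y, X x -> X y -> `|p - x| < e -> `|p - y| < e -> j x = j y ->
     x = y) ->
  exists2 d : R, 0 < d & forall c, `|j p - c| < d -> exists2 x, X x & j x = c.
Proof.
move=> Xp e0 cj injj.
have [phi [psi [r [e1 [r0 e10 [psiP phiX _ cpsi]]]]]] := surface_chart surfK Xp.
have [_ psip] : `|phi p - phi p| < r /\ psi (phi p) = p.
  by apply: phiX => //; rewrite subrr normr0.
have a0 : `|phi p - phi p| < r by rewrite subrr normr0.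
have [d d0 psid] := cpsi _ a0 e e0.
pose s := Num.min (d / 2) (r / 2).
have s0 : 0 < s by rewrite lt_min !divr_gt0.
have sd : s < d by rewrite gt_min; apply/orP; left; lra.
have sr : s < r by rewrite gt_min; apply/orP; right; lra.
pose Q := [set t : 'rV[R]_2 | `|t| <= 1]%classic.
have Q0 : Q 0 by rewrite /Q /= normr0.
pose m t := phi p + s *: t.
have pm t : Q t -> `|phi p - m t| <= s.
  move=> Qt; rewrite /m opprD addNKr normrN normrZ gtr0_norm //.
  by rewrite ger_pMr.
have mr t : Q t -> `|phi p - m t| < r by move=> /pm; move/le_lt_trans; apply.
have near t : Q t -> `|p - psi (m t)| < e.
  move=> Qt; rewrite -{1}psip; apply: psid; first exact: mr.
  exact: le_lt_trans (pm t Qt) sd.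
pose f t := j (psi (m t)).
have cf : cont_on Q f.
  move=> t Qt e2 e20.
  have [d1 d10 jd] := cj _ (psiP _ (mr t Qt)).1 e2 e20.
  have [d2 d20 pd] := cpsi _ (mr t Qt) d1 d10.
  exists (d2 / s); first by rewrite divr_gt0.
  move=> t' Qt' tt'; apply: jd; first exact: (psiP _ (mr t' Qt')).1.
  apply: pd; first exact: mr.
  rewrite /m opprD addrACA subrr add0r -scalerBr normrZ gtr0_norm //.
  by rewrite mulrC -ltr_pdivlMr.
have injf t t' : Q t -> Q t' -> f t = f t' -> t = t'.
  move=> Qt Qt' ff; have [Xt kt] := psiP _ (mr t Qt).
  have [Xt' kt'] := psiP _ (mr t' Qt').
  have pp : psi (m t) = psi (m t').
    by apply: injj => //; apply: near.
  have : m t = m t' by rewrite -kt -kt' pp.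
  by move=> /addrI; apply: scalerI; rewrite gt_eqF.
have [d1 d10 cover] := invariance_of_domain_plane cf injf.
exists d1 => // c jc; have [|t Qt ft] := cover c.
  by rewrite /f /m scaler0 addr0 psip.
by exists (psi (m t)) => //; exact: (psiP _ (mr t Qt)).1.
Qed.

(** A punctured disc of the plane is connected, so a continuous function without
    zeros near [p] except possibly at [p] has constant sign there. *)
Lemma punctured_sign (p : 'rV[R]_w) (k : 'rV[R]_w -> R) (e : R) :
  X p -> 0 < e -> cont_on X (k : _ -> R^o) ->
  (forall x, X x -> `|p - x| < e -> x <> p -> k x <> 0) ->
  exists2 d : R, 0 < d & forall x y, X x -> X y ->
    `|p - x| < d -> `|p - y| < d -> 0 < k x -> k y < 0 -> x <> p -> y <> p ->
    False.
Proof.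
move=> Xp e0 ck kn0.
have [phi [psi [r [e1 [r0 e10 [psiP phiX cphi cpsi]]]]]] :=
  surface_chart surfK Xp.
have [_ psip] : `|phi p - phi p| < r /\ psi (phi p) = p.
  by apply: phiX => //; rewrite subrr normr0.
have a0 : `|phi p - phi p| < r by rewrite subrr normr0.
have [d d0 psid] := cpsi _ a0 e e0.
pose s := Num.min d r.
have s0 : 0 < s by rewrite lt_min d0.
pose g u : R := k (psi (phi p + u)).
have inr u : `|u| < s -> `|phi p - (phi p + u)| < r.
  by rewrite opprD addNKr normrN lt_min => /andP[].
have gn0 u : `|u| < s -> u <> 0 -> g u <> 0.
  move=> us un0; have [Xu pu] := psiP _ (inr u us).
  apply: kn0 => //.
    rewrite -{1}psip; apply: psid; first exact: inr.
    by move: us; rewrite opprD addNKr normrN lt_min => /andP[].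
  move=> pup; apply: un0; move: pu; rewrite pup => E.
  by apply: (@addrI _ (phi p)); rewrite addr0.
have gc (u : 'rV[R]_2) : `|u| < s -> forall e2 : R, 0 < e2 ->
    exists2 d2 : R, 0 < d2 &
    forall v, `|v| < s -> `|u - v| < d2 -> `|g u - g v| < e2.
  move=> us e2 e20; have [d1 d10 kd] := ck _ (psiP _ (inr u us)).1 e2 e20.
  have [d2 d20 pd] := cpsi _ (inr u us) d1 d10.
  exists d2 => // v vs uv; apply: kd; first exact: (psiP _ (inr v vs)).1.
  by apply: pd; [exact: inr|rewrite opprD addrACA subrr add0r].
have segment (u v : 'rV[R]_2) : `|u| < s -> `|v| < s ->
    (forall t, 0 <= t <= 1 -> (1 - t) *: u + t *: v <> 0) ->
    0 < g u -> 0 < g v.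
  move=> us vs un0 gu; rewrite ltNge; apply/negP => gv.
  pose l t := (1 - t) *: u + t *: v.
  have ls t : 0 <= t <= 1 -> `|l t| < s.
    move=> /andP[t0 t1]; apply: le_lt_trans (ler_normD _ _) _.
    rewrite !normrZ !ger0_norm ?subr_ge0 //.
    have [->|tn0] := eqVneq t 0; first by rewrite subr0 mul1r mul0r addr0.
    have -> : s = (1 - t) * s + t * s by rewrite -mulrDl subrK mul1r.
    rewrite ler_ltD // ?ler_wpM2l ?subr_ge0 ?(ltW us) //.
    by rewrite ltr_pM2l // lt_def tn0.
  have lc t t' : `|l t - l t'| <= `|t - t'| * `|u - v|.
    have -> : l t - l t' = (t' - t) *: (u - v).
      rewrite /l; apply/rowP => i; rewrite !mxE; ring.
    by rewrite normrZ distrC.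
  have cgl : {within `[0, 1], continuous (g \o l)}%classic.
    apply/subspace_continuousP => t /=; rewrite in_itv /= => t01.
    apply/cvgrPdist_lt => e2 e20; rewrite near_withinE.
    have [d2 d20 H] := gc _ (ls t t01) e2 e20.
    apply/nbhs_ballP; exists (d2 / (`|u - v| + 1)) => /=.
      by rewrite divr_gt0 // ltr_wpDl.
    move=> t'; rewrite -ball_normE /= => tt' t'01.
    apply: H; first by apply: ls; rewrite in_itv in t'01.
    apply: le_lt_trans (lc t t') _.
    move: tt'; rewrite ltr_pdivlMr ?ltr_wpDl //; apply: le_lt_trans.
    by rewrite ler_wpM2l // lerDl.
  have [] := @IVT R (g \o l) 0 1 0 _ cgl; first exact: ler01.
    rewrite /= /l subr0 subrr scale1r !scale0r scale1r addr0 add0r.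
    by rewrite ge_min gv orbT le_max (ltW gu).
  move=> t; rewrite in_itv /= => t01 gt0.
  exact: (gn0 (l t) (ls t t01) (un0 t t01)).
pose det (u v : 'rV[R]_2) := u ord0 ord0 * v ord0 ord_max - u ord0 ord_max * v ord0 ord0.
have det0 (v : 'rV[R]_2) : det 0 v = 0 by rewrite /det !mxE !mul0r subrr.
have transverse (u v : 'rV[R]_2) : `|u| < s -> `|v| < s -> det u v <> 0 ->
    0 < g u -> 0 < g v.
  move=> us vs duv; apply: segment => // t t01 lt0; apply: duv.
  have E1 : det ((1 - t) *: u + t *: v) v = (1 - t) * det u v.
    by rewrite /det !mxE; ring.
  have E2 : det u ((1 - t) *: u + t *: v) = t * det u v.
    by rewrite /det !mxE; ring.
  have E3 : det u 0 = 0 by rewrite /det !mxE !mulr0 subrr.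
  have -> : det u v = (1 - t) * det u v + t * det u v by ring.
  by rewrite -E1 -E2 lt0 det0 E3 addr0.
have const (u v : 'rV[R]_2) : `|u| < s -> `|v| < s -> u <> 0 -> v <> 0 ->
    0 < g u -> 0 < g v.
  move=> us vs un0 vn0 gu.
  have [duv|/eqP duv] := eqVneq (det u v) 0; last exact: (transverse u v).
  (* The segment from u to v may pass through 0: make a detour through u rotated
     by a right angle. *)
  pose u' : 'rV[R]_2 := \row_i (if i == ord0 then - u ord0 ord_max else u ord0 ord0).
  have u's : `|u'| < s.
    apply: norm_rV_lt => // i; rewrite mxE; case: ifP => _; rewrite ?normrN;
    exact: le_lt_trans (coord_le_norm _ _) us.
  have du : det u u' <> 0.
    rewrite /det !mxE /= => H; apply: un0.
    have /eqP : u ord0 ord0 ^+ 2 + u ord0 ord_max ^+ 2 = 0 by rewrite -H; ring.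
    rewrite paddr_eq0 ?sqr_ge0 // !sqrf_eq0 => /andP[/eqP u0 /eqP u1].
    by apply/rowP => i; rewrite !mxE; case: (ord2P i) => ->.
  apply: (transverse u' v) => //; last exact: (transverse u u').
  move=> H; apply: vn0.
  have uu : u ord0 ord0 ^+ 2 + u ord0 ord_max ^+ 2 != 0.
    by apply/eqP => H'; apply: du; rewrite /det !mxE /= -H'; ring.
  have Hdot : u ord0 ord0 * v ord0 ord0 + u ord0 ord_max * v ord0 ord_max = 0.
    by move: H; rewrite /det !mxE /= => H; rewrite -[RHS]oppr0 -H; ring.
  have v0 : (u ord0 ord0 ^+ 2 + u ord0 ord_max ^+ 2) * v ord0 ord0 = 0.
    transitivity (u ord0 ord0 * (u ord0 ord0 * v ord0 ord0 + u ord0 ord_max * v ord0 ord_max)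
      - u ord0 ord_max * det u v); first by rewrite /det; ring.
    by rewrite Hdot duv !mulr0 subrr.
  have v1 : (u ord0 ord0 ^+ 2 + u ord0 ord_max ^+ 2) * v ord0 ord_max = 0.
    transitivity (u ord0 ord_max * (u ord0 ord0 * v ord0 ord0 + u ord0 ord_max * v ord0 ord_max)
      + u ord0 ord0 * det u v); first by rewrite /det; ring.
    by rewrite Hdot duv !mulr0 addr0.
  apply/rowP => i; rewrite !mxE; apply/eqP.
  case: (ord2P i) => ->; [move/eqP: v0|move/eqP: v1];
    by rewrite mulf_eq0 (negbTE uu).
have p0 : X p /\ `|p - p| < e1 by rewrite subrr normr0.
have [d1 d10 phid] := cphi _ p0 s s0.
exists (Num.min d1 e1); first by rewrite lt_min d10.
have back x : X x -> `|p - x| < Num.min d1 e1 ->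
    `|phi x - phi p| < s /\ g (phi x - phi p) = k x.
  move=> Xx; rewrite lt_min => /andP[xd1 xe1]; split.
    by rewrite distrC; apply: phid.
  by rewrite /g addrC subrK (phiX _ Xx xe1).2.
move=> x y Xx Xy px py kx ky xp yp.
have [xs gx] := back x Xx px; have [ys gy] := back y Xy py.
have neq z : X z -> `|p - z| < Num.min d1 e1 -> z <> p -> phi z - phi p <> 0.
  move=> Xz; rewrite lt_min => /andP[_ ze1] zp /eqP; rewrite subr_eq0 => /eqP E.
  by apply: zp; rewrite -(phiX _ Xz ze1).2 E psip.
have := const _ _ xs ys (neq x Xx px xp) (neq y Xy py yp).
by rewrite gx gy => /(_ kx) /(lt_trans ky); rewrite ltxx.
Qed.

End Local.

(** * Combinatorics of a triangulated surface *)

Definition edge (w : nat) (K : {set {set 'I_w}}) (a b : 'I_w) : bool :=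
  (a != b) && ([set a; b]%SET \in K).

Definition face (w : nat) (K : {set {set 'I_w}}) (a b c : 'I_w) : bool :=
  [&& a != b, a != c, b != c & [set a; b; c]%SET \in K].

(** The consequences of being a connected closed surface on which the count
    rests: faces have at most three vertices, every edge is in exactly two
    triangles, the links of the vertices are connected, and so is the
    1-skeleton. *)
Record combinatorial_surface (w : nat) (K : {set {set 'I_w}}) : Prop :=
  CombinatorialSurface {
    cs_complex : simplicial_complex K;
    cs_dim : forall s, s \in K -> (#|s| <= 3)%N;
    cs_face : forall a b, edge K a b -> exists c, face K a b c;
    cs_other : forall a b c, face K a b c -> exists2 d, d != c & face K a b d;
    cs_two : forall a b c d e, face K a b c -> face K a b d -> face K a b e ->
      [\/ c = d, c = e | d = e];
    cs_link : forall (v : 'I_w) (S : {set 'I_w}),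
      (forall b c, b \in S -> face K v b c -> c \in S) ->
      forall b c, b \in S -> edge K v b -> edge K v c -> c \in S;
    cs_connected : forall S : {set 'I_w},
      (forall a b, a \in S -> edge K a b -> b \in S) ->
      forall a b, a \in S -> b \in S }.

Section Faces.
Context {w : nat} (K : {set {set 'I_w}}).
Hypothesis cK : simplicial_complex K.

Lemma complex_sub (s t : {set 'I_w}) :
  s \in K -> t != finset.set0 -> t \subset s -> t \in K.
Proof.
move=> sK t0 ts; have /and3P[_ _ /forall_inP/(_ s sK)/forallP/(_ t)] := cK.
by rewrite t0 ts.
Qed.

Lemma face_edge a b c : face K a b c -> edge K a b.
Proof.
case/and4P=> ab _ _ abcK; rewrite /edge ab; apply: complex_sub abcK _ _.
  by apply/finset.set0Pn; exists a; rewrite !inE eqxx.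
exact: finset.subsetUl.
Qed.

Lemma face_sub a b c (s : {set 'I_w}) : s \in K -> a != b -> a != c -> b != c ->
  a \in s -> b \in s -> c \in s -> face K a b c.
Proof.
move=> sK ab ac bc sa sb sc; rewrite /face ab ac bc; apply: complex_sub sK _ _.
  by apply/finset.set0Pn; exists a; rewrite !inE eqxx.
by rewrite !finset.subUset !finset.sub1set sa sb sc.
Qed.

Lemma edge_sub a b (s : {set 'I_w}) : s \in K -> a != b ->
  a \in s -> b \in s -> edge K a b.
Proof.
move=> sK ab sa sb; rewrite /edge ab; apply: complex_sub sK _ _.
  by apply/finset.set0Pn; exists a; rewrite !inE eqxx.
by rewrite !finset.subUset !finset.sub1set sa sb.
Qed.

End Faces.

Section Points.
Context {R : realType} {w : nat} (K : {set {set 'I_w}}).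
Hypothesis cK : simplicial_complex K.
Local Notation X := (@realization R w K).
Local Notation e_ v := (delta_mx ord0 v : 'rV[R]_w).

Definition pt4 (a b c d : 'I_w) (p q r s : R) : 'rV[R]_w :=
  p *: e_ a + q *: e_ b + r *: e_ c + s *: e_ d.

Lemma pt4E a b c d p q r s v : pt4 a b c d p q r s ord0 v =
  (if v == a then p else 0) + (if v == b then q else 0)
  + (if v == c then r else 0) + (if v == d then s else 0).
Proof.
by rewrite /pt4 !mxE /=; do 4!case: (v == _); rewrite ?mulr1 ?mulr0.
Qed.

Lemma sum_delta (a : 'I_w) (p : R) : \sum_v (if v == a then p else 0) = p.
Proof. by rewrite -big_mkcond /= big_pred1_eq. Qed.

Lemma realization_pt4 (t : {set 'I_w}) a b c d (p q r s : R) :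
  0 <= p -> 0 <= q -> 0 <= r -> 0 <= s -> p + q + r + s = 1 -> t \in K ->
  (p != 0 -> a \in t) -> (q != 0 -> b \in t) -> (r != 0 -> c \in t) ->
  (s != 0 -> d \in t) -> X (pt4 a b c d p q r s).
Proof.
move=> p0 q0 r0 s0 sum1 tK pa qb rc sd.
have S1 : \sum_v pt4 a b c d p q r s ord0 v = 1.
  rewrite -sum1 -[in RHS](sum_delta a p) -[in RHS](sum_delta b q).
  rewrite -[in RHS](sum_delta c r) -[in RHS](sum_delta d s) -!big_split /=.
  by apply: eq_bigr => v _; rewrite pt4E.
split=> //.
  by move=> v; rewrite pt4E !addr_ge0 //; case: ifP.
apply: (complex_sub cK tK).
  apply/eqP => supp0; move/eqP: S1; rewrite big1 ?(eq_sym 0) ?oner_eq0 //.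
  move=> v _; apply/eqP; have : v \notin face_support (pt4 a b c d p q r s).
    by rewrite supp0 inE.
  by rewrite inE negbK.
apply/fintype.subsetP => v; rewrite inE pt4E => nz; apply: contraR nz => vt.
have z (x : R) u : (x != 0 -> u \in t) -> (if v == u then x else 0) = 0.
  case: (eqVneq v u) => [<- xv|//]; apply/eqP; apply: contraR vt => /xv //.
by rewrite (z p a pa) (z q b qb) (z r c rc) (z s d sd) !addr0.
Qed.

Lemma norm_delta (v : 'I_w) : `|e_ v| <= 1.
Proof.
apply: norm_rV_le => // i; rewrite !mxE /=.
by case: (i == v); rewrite ?normr1 ?normr0.
Qed.

Lemma pt4_close a b c d (p q r s p' q' r' s' : R) :
  `|pt4 a b c d p q r s - pt4 a b c d p' q' r' s'| <=
    `|p - p'| + `|q - q'| + `|r - r'| + `|s - s'|.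
Proof.
have -> : pt4 a b c d p q r s - pt4 a b c d p' q' r' s' =
    pt4 a b c d (p - p') (q - q') (r - r') (s - s').
  by apply/rowP => v; rewrite [LHS]mxE [X in _ + X]mxE !pt4E;
    do 4!case: (v == _); ring.
have le1 (x : R) v : `|x *: e_ v| <= `|x|.
  by rewrite normrZ; apply: ler_piMr => //; apply: norm_delta.
apply: le_trans (ler_normD _ _) _; rewrite lerD //.
apply: le_trans (ler_normD _ _) _; rewrite lerD //.
by apply: le_trans (ler_normD _ _) _; rewrite lerD.
Qed.

End Points.

Section SurfaceFacts.
Context {R : realType} {w : nat} (K : {set {set 'I_w}}).
Hypothesis surfK : triangulated_surface R K.
Local Notation X := (@realization R w K).
Local Notation e_ v := (delta_mx ord0 v : 'rV[R]_w).
Let cK : simplicial_complex K := surfK.1.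

Let cont_pt4 (a b c d : 'I_w) (p q r s : 'rV[R]_2 -> R) (A : set 'rV[R]_2) :
  (forall u v, `|p u - p v| <= `|u - v|) ->
  (forall u v, `|q u - q v| <= `|u - v|) ->
  (forall u v, `|r u - r v| <= `|u - v|) ->
  (forall u v, `|s u - s v| <= `|u - v|) ->
  cont_on A (fun u => pt4 a b c d (p u) (q u) (r u) (s u)).
Proof.
move=> Lp Lq Lr Ls; apply: (@lipschitz_cont_on _ _ _ _ _ 4) => // u v.
apply: le_trans (pt4_close _ _ _ _ _ _ _ _ _ _ _ _) _.
by have := (Lp u v, Lq u v, Lr u v, Ls u v) => -[[[]]]; lra.
Qed.

Let coord_dist (u v : 'rV[R]_2) k : `|u ord0 k - v ord0 k| <= `|u - v|.
Proof. by have := coord_le_norm (u - v) k; rewrite !mxE. Qed.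

Let unit_coord (u : 'rV[R]_2) k : `|u| <= 1 -> -1 <= u ord0 k <= 1.
Proof. by move=> u1; rewrite -ler_norml (le_trans (coord_le_norm u k)). Qed.

(** A small flat disc inside a 3-simplex would be a neighbourhood of its centre,
    which it is not. *)
Lemma surface_dim s : s \in K -> (#|s| <= 3)%N.
Proof.
move=> sK; rewrite leqNgt; apply/negP => /card_geqP[l [+ + sub]].
case: l sub => [//|a [//|b [//|c [//|d []//]]]] sub + _.
rewrite /= !inE !negb_or -!andbA.
move=> /and5P[ab ac ad bc] /and3P[bd cd _].
have sa : a \in s by apply: sub; rewrite !inE eqxx ?orbT.
have sb : b \in s by apply: sub; rewrite !inE eqxx ?orbT.
have sc : c \in s by apply: sub; rewrite !inE eqxx ?orbT.
have sd : d \in s by apply: sub; rewrite !inE eqxx ?orbT.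
pose q (u : 'rV[R]_2) := pt4 a b c d (4^-1 + u ord0 ord0 / 16)
  (4^-1 + u ord0 ord_max / 16)
  (4^-1 - u ord0 ord0 / 16 - u ord0 ord_max / 16) 4^-1.
have qd u : q u ord0 d = 4^-1.
  by rewrite pt4E eqxx !(eq_sym d) (negbTE ad) (negbTE bd) (negbTE cd) /= !add0r.
have [||u Qu|e e0 nbh] := disc_nbhd surfK (q := q).
- by apply: cont_pt4 => u v; have := coord_dist u v ord0;
    have := coord_dist u v ord_max; rewrite !ler_norml; lra.
- move=> u v _ _ quv; apply/rowP => k.
  have := congr1 (fun x : 'rV[R]_w => x ord0 a) quv.
  have := congr1 (fun x : 'rV[R]_w => x ord0 b) quv.
  rewrite /= !pt4E !eqxx !(eq_sym b a) (negbTE ab) (negbTE ac) (negbTE ad).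
  rewrite (negbTE bc) (negbTE bd) /=.
  by case: (ord2P k) => ->; lra.
- have := unit_coord ord0 Qu; have := unit_coord ord_max Qu => u1 u0.
  by apply: (@realization_pt4 _ _ _ cK s) => //; lra.
pose tau := Num.min (e / 4) (8^-1).
have tau0 : 0 < tau by rewrite lt_min divr_gt0 //=; lra.
have tau1 : tau <= 8^-1 by rewrite ge_min lexx orbT.
have taue : tau <= e / 4 by rewrite ge_min lexx.
pose x := pt4 a b c d (4^-1 + tau) 4^-1 4^-1 (4^-1 - tau).
have Xx : X x by apply: (@realization_pt4 _ _ _ cK s) => //; lra.
have [|t _ qt] := nbh x Xx.
  apply: le_lt_trans (pt4_close _ _ _ _ _ _ _ _ _ _ _ _) _; rewrite !mxE.
  have -> : 4^-1 + 0 / 16 - (4^-1 + tau) = - tau by lra.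
  have -> : 4^-1 + 0 / 16 - 4^-1 = 0 :> R by lra.
  have -> : 4^-1 - 0 / 16 - 0 / 16 - 4^-1 = 0 :> R by lra.
  have -> : 4^-1 - (4^-1 - tau) = tau by lra.
  by rewrite normrN normr0 gtr0_norm //; lra.
have := qd t; rewrite qt pt4E eqxx !(eq_sym d) (negbTE ad) (negbTE bd).
by rewrite (negbTE cd) /=; lra.
Qed.

(** Two of three triangles on an edge form a disc that misses the third. *)
Lemma surface_two a b c d e : face K a b c -> face K a b d -> face K a b e ->
  [\/ c = d, c = e | d = e].
Proof.
move=> Fc Fd Fe; have [->|cd] := eqVneq c d; first by constructor 1.
have [->|ce] := eqVneq c e; first by constructor 2.
have [->|de] := eqVneq d e; first by constructor 3.
exfalso; case/and4P: Fc => ab ac bc cF; case/and4P: Fd => _ ad bd dF.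
case/and4P: Fe => _ ae be eF.
pose q (u : 'rV[R]_2) := pt4 a b c d
  (2^-1 + u ord0 ord0 / 8 - `|u ord0 ord_max| / 8)
  (2^-1 - u ord0 ord0 / 8 - `|u ord0 ord_max| / 8)
  (Num.max 0 (u ord0 ord_max) / 4) (Num.max 0 (- u ord0 ord_max) / 4).
(* The upper half of the square goes to one triangle, the lower half to the
   other, and the horizontal axis to the common edge. *)
have maxP (x : R) : [\/ 0 <= x /\ [/\ `|x| = x, Num.max 0 x = x & Num.max 0 (- x) = 0]
    | x <= 0 /\ [/\ `|x| = - x, Num.max 0 x = 0 & Num.max 0 (- x) = - x]].
  case/orP: (le_total 0 x) => x0; [left|right]; split=> //; split.
  - exact: ger0_norm.
  - exact: max_r.
  - by apply: max_l; rewrite oppr_le0.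
  - exact: ler0_norm.
  - exact: max_l.
  - by apply: max_r; rewrite oppr_ge0.
have [||u Qu|eps eps0 nbh] := disc_nbhd surfK (q := q).
- apply: cont_pt4 => u v; have := coord_dist u v ord0;
    have := coord_dist u v ord_max; rewrite !ler_norml;
    case: (maxP (u ord0 ord_max)) => -[U0 [U1 U2 U3]];
    case: (maxP (v ord0 ord_max)) => -[V0 [V1 V2 V3]];
    rewrite ?U1 ?U2 ?U3 ?V1 ?V2 ?V3; lra.
- move=> u v _ _ quv; apply/rowP => k.
  have := congr1 (fun x : 'rV[R]_w => x ord0 a) quv.
  have := congr1 (fun x : 'rV[R]_w => x ord0 b) quv.
  have := congr1 (fun x : 'rV[R]_w => x ord0 c) quv.
  have := congr1 (fun x : 'rV[R]_w => x ord0 d) quv.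
  rewrite /= !pt4E !eqxx !(eq_sym b a) !(eq_sym c a) !(eq_sym c b) !(eq_sym d).
  rewrite (negbTE ab) (negbTE ac) (negbTE ad) (negbTE bc) (negbTE bd) (negbTE cd) /=.
  case: (maxP (u ord0 ord_max)) => -[U0 [U1 U2 U3]];
  case: (maxP (v ord0 ord_max)) => -[V0 [V1 V2 V3]];
  by rewrite U1 U2 U3 ?V1 ?V2 ?V3; case: (ord2P k) => ->; lra.
- have := unit_coord ord0 Qu; have := unit_coord ord_max Qu.
  rewrite /q; case: (maxP (u ord0 ord_max)) => -[? [-> -> ->]] ? ?.
    apply: (@realization_pt4 _ _ _ cK [set a; b; c]%SET) => //;
      rewrite ?inE ?eqxx ?orbT //; try lra.
  apply: (@realization_pt4 _ _ _ cK [set a; b; d]%SET) => //;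
      rewrite ?inE ?eqxx ?orbT //; try lra.
pose tau := Num.min (eps / 4) (8^-1).
have tau0 : 0 < tau by rewrite lt_min divr_gt0 //=; lra.
have tau1 : tau <= 8^-1 by rewrite ge_min lexx orbT.
have taue : tau <= eps / 4 by rewrite ge_min lexx.
pose x := pt4 a b e e (2^-1 - tau) 2^-1 tau 0.
have Xx : X x.
  apply: (@realization_pt4 _ _ _ cK [set a; b; e]%SET) => //;
    rewrite ?inE ?eqxx ?orbT //; lra.
have q0 : q 0 = pt4 a b e e 2^-1 2^-1 0 0.
  apply/rowP => v; rewrite !pt4E !mxE !oppr0 maxxx normr0;
  do 5!case: (v == _); lra.
have [|t _ qt] := nbh x Xx.
  rewrite q0; apply: le_lt_trans (pt4_close _ _ _ _ _ _ _ _ _ _ _ _) _.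
  have -> : 2^-1 - (2^-1 - tau) = tau by lra.
  by rewrite !subrr !normr0 sub0r normrN gtr0_norm //; lra.
have := congr1 (fun x : 'rV[R]_w => x ord0 e) qt.
rewrite /= !pt4E eqxx !(eq_sym e) (negbTE ae) (negbTE be) (negbTE ce) (negbTE de) /=.
by lra.
Qed.

End SurfaceFacts.

Lemma coord_dist_lt (R : realType) n (x y : 'rV[R]_n) k (e : R) :
  `|x - y| < e -> `|x ord0 k - y ord0 k| < e.
Proof. by move/(le_lt_trans (coord_le_norm (x - y) k)); rewrite !mxE. Qed.

Section SurfaceFacts2.
Context {R : realType} {w : nat} (K : {set {set 'I_w}}).
Hypothesis surfK : triangulated_surface R K.
Local Notation X := (@realization R w K).
Local Notation e_ v := (delta_mx ord0 v : 'rV[R]_w).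
Let cK : simplicial_complex K := surfK.1.

Lemma realization_edge (x : 'rV[R]_w) a b : X x -> a != b ->
  x ord0 a != 0 -> x ord0 b != 0 -> edge K a b.
Proof. by case=> _ _ sK ab xa xb; apply: (edge_sub cK sK); rewrite ?inE. Qed.

Lemma realization_face (x : 'rV[R]_w) a b c : X x ->
  a != b -> a != c -> b != c ->
  x ord0 a != 0 -> x ord0 b != 0 -> x ord0 c != 0 -> face K a b c.
Proof. by case=> _ _ sK *; apply: (face_sub cK sK); rewrite ?inE. Qed.

(** With at most one triangle on an edge, a neighbourhood of its midpoint embeds
    in a closed half plane with the midpoint on the boundary, contrary to
    [planar_nbhd]. *)
Lemma surface_two_faces a b : edge K a b ->
  exists c d, [/\ c != d, face K a b c & face K a b d].
Proof.
move=> /andP[ab abK]; apply: contrapT => no2.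
have uniq c d : face K a b c -> face K a b d -> c = d.
  move=> Fc Fd; apply/eqP; apply: contraT => cd.
  by exfalso; apply: no2; exists c, d.
pose j (x : 'rV[R]_w) : 'rV[R]_2 :=
  \row_i (if i == ord0 then x ord0 a else 1 - x ord0 a - x ord0 b).
pose p := pt4 a b a a (2^-1 : R) 2^-1 0 0.
have Xp : X p.
  apply: (@realization_pt4 _ _ _ cK [set a; b]%SET) => //;
    rewrite ?inE ?eqxx ?orbT //; lra.
have pa : p ord0 a = 2^-1 by rewrite pt4E eqxx (negbTE ab); lra.
have pb : p ord0 b = 2^-1 by rewrite pt4E eqxx eq_sym (negbTE ab); lra.
have cj : cont_on X j.
  apply: (@lipschitz_cont_on _ _ _ _ _ 2) => // x y.
  apply: norm_rV_le => [|i]; first by rewrite mulr_ge0.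
  have := coord_le_norm (x - y) a; have := coord_le_norm (x - y) b.
  by rewrite !mxE !ler_norml; case: ifP => _; lra.
have sumX x : X x -> x ord0 a + x ord0 b
    + \sum_(v | (v != a) && (v != b)) x ord0 v = 1.
  move=> [_ <- _]; rewrite [in RHS](bigD1 a) //=.
  by rewrite [in RHS](bigD1 b) ?addrA // eq_sym.
have rest0 x : X x -> forall v, 0 <= x ord0 v by case.
have apex x v : X x -> x ord0 a != 0 -> x ord0 b != 0 -> v != a -> v != b ->
    x ord0 v != 0 -> face K a b v.
  move=> Xx xa xb va vb xv; apply: (realization_face Xx) => //.
    by rewrite eq_sym.
  by rewrite eq_sym.
have near x : `|p - x| < 4^-1 -> x ord0 a != 0 /\ x ord0 b != 0.
  move=> px; have := coord_dist_lt a px; have := coord_dist_lt b px.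
  rewrite pa pb !ltr_norml => ? ?.
  by split; apply/eqP => H; move: H; lra.
have q0 : (0 : R) < 4^-1 by rewrite invr_gt0.
clearbody p.
have [|d d0 nbh] := planar_nbhd surfK Xp q0 cj.
  move=> x y Xx Xy /near[xa xb] /near[ya yb] jxy.
  have Ea : x ord0 a = y ord0 a.
    by have := congr1 (fun z : 'rV[R]_2 => z ord0 ord0) jxy; rewrite !mxE.
  have Eb : x ord0 b = y ord0 b.
    have := congr1 (fun z : 'rV[R]_2 => z ord0 ord_max) jxy.
    by rewrite !mxE /= Ea; lra.
  have alone z z' v : X z -> X z' -> z ord0 a != 0 -> z ord0 b != 0 ->
      z' ord0 a != 0 -> z' ord0 b != 0 -> v != a -> v != b ->
      z ord0 v != 0 -> z' ord0 v = 1 - z' ord0 a - z' ord0 b.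
    move=> Xz Xz' za zb z'a z'b va vb zv.
    have := sumX z' Xz'; rewrite (bigD1 v) ?va //= big1 ?addr0; first lra.
    move=> u /andP[/andP[ua ub] uv]; apply/eqP; apply: contraR uv => z'u.
    by apply/eqP/uniq; [apply: (apex z')|apply: (apex z)].
  apply/rowP => v; have [->//|va] := eqVneq v a; have [->//|vb] := eqVneq v b.
  have [x0|xv] := eqVneq (x ord0 v) 0; last first.
    by rewrite (alone x x v) // (alone x y v) // Ea Eb.
  have [y0|yv] := eqVneq (y ord0 v) 0; first by rewrite x0 y0.
  by rewrite (alone y x v) // (alone y y v) // Ea Eb.
pose c : 'rV[R]_2 := \row_i (if i == ord0 then 2^-1 else - (d / 2)).
have [|x Xx jx] := nbh c.
  apply: norm_rV_lt => // i; rewrite !mxE pa pb; case: ifP => _.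
    by rewrite subrr normr0.
  by rewrite ltr_norml; apply/andP; split; lra.
have := congr1 (fun z : 'rV[R]_2 => z ord0 ord_max) jx; rewrite !mxE /=.
have : 0 <= \sum_(v | (v != a) && (v != b)) x ord0 v.
  by apply: sumr_ge0 => v _; apply: rest0.
by have := sumX x Xx; lra.
Qed.

(** The two sides of a disconnected link would disconnect a punctured
    neighbourhood of the vertex. *)
Lemma surface_link (v : 'I_w) (S : {set 'I_w}) :
  (forall b c, b \in S -> face K v b c -> c \in S) ->
  forall b c, b \in S -> edge K v b -> edge K v c -> c \in S.
Proof.
move=> Scl b c bS vb vc; apply: contraT => cS; exfalso.
have bv : b != v by case/andP: vb; rewrite eq_sym.
have cv : c != v by case/andP: vc; rewrite eq_sym.
pose s u : R := if u == v then 0 else if u \in S then 1 else -1.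
pose k (x : 'rV[R]_w) : R := \sum_u s u * x ord0 u.
pose p : 'rV[R]_w := pt4 v v v v 1 0 0 0.
have vK : [set v]%SET \in K by have /and3P[_ /forallP/(_ v)] := cK.
have Xp : X p.
  by apply: (@realization_pt4 _ _ _ cK [set v]%SET) => //;
    rewrite ?inE ?eqxx //; lra.
have kpt u t : u != v -> k (pt4 v u v v (1 - t) t 0 0) = s u * t.
  move=> uv; rewrite /k (bigD1 u) //= big1 ?addr0.
    by rewrite pt4E eqxx (negbTE uv); congr (_ * _); rewrite /=; lra.
  move=> u' u'u; rewrite pt4E (negbTE u'u) /s.
  by case: eqVneq => _; rewrite ?mul0r // !add0r ?mulr0.
have ck : cont_on X (k : _ -> R^o).
  apply: (@lipschitz_cont_on _ _ R^o _ _ (w%:R + 1)).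
    by rewrite ltr_wpDl.
  move=> x y; rewrite /k -sumrB.
  apply: le_trans (ler_norm_sum _ _ _) _.
  apply: (@le_trans _ _ (\sum_(u < w) `|x - y|)).
    apply: ler_sum => u _; rewrite -mulrBr normrM.
    have su : `|s u| <= 1.
      by rewrite /s; case: ifP => _; [|case: ifP => _];
        rewrite ?normr0 ?normr1 ?normrN1.
    apply: le_trans (ler_piMl _ su) _ => //.
    by have := coord_le_norm (x - y) u; rewrite !mxE.
  rewrite sumr_const card_ord -[leLHS]mulr_natl ler_wpM2r //.
  by rewrite lerDl.
have pv : p ord0 v = 1 by rewrite pt4E eqxx /=; lra.
have kn0 x : X x -> `|p - x| < 1 -> x <> p -> k x <> 0.
  move=> Xx px xp kx0; have [x0 x1 _] := Xx.
  have xv : x ord0 v != 0.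
    have := coord_dist_lt v px.
    by rewrite pv ltr_norml => ?; apply/eqP => H; move: H; lra.
  have mono b' c' : b' \in S -> c' \notin S -> c' != v -> b' != v ->
      x ord0 b' != 0 -> x ord0 c' = 0.
    move=> b'S c'S c'v b'v xb; apply/eqP; apply: contraR c'S => xc.
    have [<-//|b'c'] := eqVneq b' c'.
    by apply: (Scl b' c') => //; apply: (realization_face Xx) => //; rewrite eq_sym.
  have all0 u : u != v -> x ord0 u = 0.
    have zero (r : 'I_w -> R) : (forall u, 0 <= r u) -> \sum_u r u = 0 ->
        forall u, r u = 0.
      move=> r0 /eqP; rewrite psumr_eq0 // => /allP H u'.
      by apply/eqP/H; rewrite mem_index_enum.
    have [/existsP[b' /and3P[b'v b'S xb]]|noS] :=
        boolP [exists b', [&& b' != v, b' \in S & x ord0 b' != 0]].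
      have sx u' : 0 <= s u' * x ord0 u'.
        rewrite /s; case: eqVneq => [_|u'v]; first by rewrite mul0r.
        case: ifPn => u'S; first by rewrite mul1r.
        by rewrite (mono b' u') // mulr0.
      have := zero _ sx kx0 b'; rewrite /s (negbTE b'v) b'S mul1r => E.
      by rewrite E eqxx in xb.
    have Sx u' : u' != v -> u' \in S -> x ord0 u' = 0.
      move=> u'v u'S; apply/eqP; apply: contraR noS => xu.
      by apply/existsP; exists u'; rewrite u'v u'S.
    have sx u' : 0 <= - s u' * x ord0 u'.
      rewrite /s; case: eqVneq => [_|u'v]; first by rewrite oppr0 mul0r.
      case: ifPn => u'S; first by rewrite Sx // mulr0.
      by rewrite opprK mul1r.
    move=> uv; have [uS|uS] := boolP (u \in S); first exact: Sx.
    have sum0 : \sum_u' - s u' * x ord0 u' = 0.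
      transitivity (- k x); last by rewrite kx0 oppr0.
      rewrite /k -sumrN.
      by apply: eq_bigr => u' _; rewrite mulNr.
    by have := zero _ sx sum0 u; rewrite /s (negbTE uv) (negbTE uS) opprK mul1r.
  apply: xp; apply/rowP => u; rewrite pt4E.
  have [->|uv] := eqVneq u v; last by rewrite all0 //; lra.
  move: x1; rewrite (bigD1 v) //= big1 => [|u' u'v]; last exact: all0.
  lra.
have [d d0 const] := punctured_sign surfK Xp ltr01 ck kn0.
pose t := Num.min (d / 4) 2^-1.
have t0 : 0 < t by rewrite lt_min divr_gt0 //= invr_gt0.
have t1 : t <= 2^-1 by rewrite ge_min lexx orbT.
have td : t <= d / 4 by rewrite ge_min lexx.
have Xt u : edge K v u -> X (pt4 v u v v (1 - t) t 0 0).
  case/andP => _ vuK; apply: (@realization_pt4 _ _ _ cK [set v; u]%SET) => //;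
    rewrite ?inE ?eqxx ?orbT //; lra.
have nt u : `|p - pt4 v u v v (1 - t) t 0 0| < d.
  have -> : p = pt4 v u v v 1 0 0 0.
    by apply/rowP => u'; rewrite !pt4E; do 2!case: (u' == _); lra.
  apply: le_lt_trans (pt4_close _ _ _ _ _ _ _ _ _ _ _ _) _.
  by rewrite subKr sub0r normrN !subrr normr0 gtr0_norm //; lra.
have neq u : u != v -> pt4 v u v v (1 - t) t 0 0 <> p.
  move=> uv /(congr1 (fun x : 'rV[R]_w => x ord0 u)).
  by rewrite !pt4E eqxx (negbTE uv) /=; lra.
apply: (const _ _ (Xt b vb) (Xt c vc) (nt b) (nt c) _ _ (neq b bv) (neq c cv)).
  by rewrite kpt // /s (negbTE bv) bS mul1r.
by rewrite kpt // /s (negbTE cv) (negbTE cS) mulN1r oppr_lt0.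
Qed.

(** The barycentric coordinates of the vertices in [S] add up to 0 or 1 at each
    point, so their sum would be a continuous function onto two values. *)
Lemma connected_skeleton : connected_complex R K -> forall S : {set 'I_w},
  (forall a b, a \in S -> edge K a b -> b \in S) ->
  forall a b, a \in S -> b \in S.
Proof.
move=> conn S Scl a b aS; apply: contraT => bS; exfalso.
pose g (x : X) : R := \sum_(u in S) (\val x) ord0 u.
have cg : continuous g.
  pose G (x : 'rV[R]_w) : R := \sum_(u in S) x ord0 u.
  suff cG : continuous G.
    move=> x; apply: (@continuous_comp X 'rV[R]_w R \val G).
      exact: set_val_continuous.
    exact: cG.
  move=> x N /nbhs_ballP[e /= e0 eN].
  have ck : cont_on [set: 'rV[R]_w]%classic
      ((fun x : 'rV[R]_w => \sum_(u in S) x ord0 u) : _ -> R^o).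
    apply: (@lipschitz_cont_on _ _ R^o _ _ (#|S|%:R + 1)).
      by rewrite ltr_wpDl.
    move=> y z; rewrite -sumrB.
    apply: le_trans (ler_norm_sum _ _ _) _.
    apply: (@le_trans _ _ (\sum_(u in S) `|y - z|)).
      by apply: ler_sum => u _; have := coord_le_norm (y - z) u; rewrite !mxE.
    by rewrite sumr_const -[leLHS]mulr_natl ler_wpM2r // lerDl.
  have [d d0 H] := ck x I e e0.
  apply/nbhs_ballP; exists d => // y; rewrite -ball_normE /= => xy.
  by apply: eN; rewrite -ball_normE; apply: H.
have g01 x : g x = 0 \/ g x = 1.
  have [x0 x1 xK] := set_valP x.
  have [|/existsP] := boolP [exists u, (u \in S) && (\val x ord0 u != 0)];
      last first.
    move=> no; left; apply: big1 => u uS; apply/eqP; apply: contrapT => xu.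
    by apply: no; exists u; rewrite uS; apply/negP.
  move=> /existsP[u /andP[uS xu]]; right; rewrite -x1 /g [RHS](bigID (mem S)) /=.
  rewrite [X in _ + X]big1 ?addr0 // => u' u'S; apply/eqP.
  apply: contraR u'S => xu'; have [<-//|uu'] := eqVneq u u'.
  by apply: (Scl u) => //; apply: (realization_edge (set_valP x)).
have pt u : exists x : X, g x = (u \in S)%:R.
  pose y : 'rV[R]_w := pt4 u u u u 1 0 0 0.
  have uK : [set u]%SET \in K by have /and3P[_ /forallP/(_ u)] := cK.
  have Xy : X y.
    by apply: (@realization_pt4 _ _ _ cK [set u]%SET) => //;
      rewrite ?inE ?eqxx //; lra.
  exists (exist _ y (mem_set Xy)); rewrite /g /=.
  have yE u' : y ord0 u' = if u' == u then 1 else 0.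
    by rewrite pt4E; case: (u' == u); lra.
  under eq_bigr do rewrite yE.
  have [uS|uS] := boolP (u \in S).
    rewrite (bigD1 u) //= eqxx big1 ?addr0 // => u' /andP[_ /negbTE ->] //.
  by rewrite big1 // => u' u'S; case: eqVneq => // E; rewrite -E u'S in uS.
have [xa ga] := pt a; have [xb gb] := pt b.
have cont : {within [set: X], continuous g}%classic.
  exact: continuous_subspaceT.
have := connected_continuous_connected conn cont.
move=> /connected_intervalP/(_ 0 1); case/(_ _ _ 2^-1).
- by exists xb => //; rewrite gb (negbTE bS).
- by exists xa => //; rewrite ga aS.
- by apply/andP; split; lra.
- by move=> x _; case: (g01 x) => ->; lra.
Qed.

Lemma combinatorial_surfaceP : connected_complex R K -> combinatorial_surface K.
Proof.
move=> conn; split.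
- exact: cK.
- exact: surface_dim surfK.
- by move=> a b /surface_two_faces[c [_ [_ Fc _]]]; exists c.
- move=> a b c /(face_edge cK)/surface_two_faces[d [e [de Fd Fe]]].
  have [dc|dc] := eqVneq d c; last by exists d.
  by exists e => //; rewrite -dc eq_sym.
- exact: surface_two surfK.
- exact: surface_link.
- exact: connected_skeleton.
Qed.

End SurfaceFacts2.

(** * Counting gluings *)

Lemma even_fpf_involution (T : finType) (h : T -> T) (A : {set T}) :
  {in A, forall y, h y \in A} -> {in A, forall y, h (h y) = y} ->
  {in A, forall y, h y != y} -> ~~ odd #|A|.
Proof.
elim: {A}#|A| {-2}A (leqnn #|A|) => [|n IHn] A.
  by rewrite leqn0 => /eqP ->.
move=> leA hA hK hn; have [->|/finset.set0Pn[y yA]] := eqVneq A finset.set0.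
  by rewrite cards0.
have hyA := hA y yA; have hyn := hn y yA.
pose A' := (A :\ y :\ h y)%SET.
have cA : #|A| = #|A'|.+2.
  by rewrite (finset.cardsD1 y) yA (finset.cardsD1 (h y) (A :\ y)%SET)
    !inE hyn hyA.
rewrite cA /= negbK; apply: IHn; first by rewrite cA ltnS in leA; apply: ltnW.
- move=> z; rewrite !inE => /and3P[zh zy zA].
  rewrite (hA z zA) andbT; apply/andP; split.
    by apply: contra zy => /eqP E; rewrite -(hK z zA) E hK.
  by apply: contra zh => /eqP E; rewrite -E hK.
- by move=> z; rewrite !inE => /and3P[_ _ zA]; apply: hK.
- by move=> z; rewrite !inE => /and3P[_ _ zA]; apply: hn.
Qed.

Section Gluings.
Context {X : finType} (iota beta : X -> X).
Hypotheses (iotaK : involutive iota) (iota_fpf : forall x, iota x != x).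
Hypotheses (betaK : involutive beta) (beta_fpf : forall x, beta x != x).

(** [X] is the set of flags of a set of polygons: [iota] moves to the other end
    of the same side and [beta] to the other side at the same corner.  A gluing
    [g] of the sides is recorded together with the vertex [c x] of each flag. *)
Record gluing (V : finType) (g : X -> X) (c : X -> V) : Prop := Gluing {
  gl_inv : involutive g;
  gl_fpf : forall x, g x != x;
  gl_iota : forall x, g (iota x) = iota (g x);
  gl_vbeta : forall x, c (beta x) = c x;
  gl_vg : forall x, c (g x) = c x;
  gl_noloop : forall x, c (iota x) != c x;
  gl_simple : forall x y, c x = c y -> c (iota x) = c (iota y) ->
    y = x \/ y = g x;
  gl_connected : forall S : {set V}, (forall x, c x \in S -> c (iota x) \in S) ->
    forall a b, a \in S -> b \in S }.

Definition spanning_tree (V : finType) (c : X -> V) (r : V) (par : V -> V)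
    (d : V -> nat) : Prop :=
  forall v, v != r ->
    (d (par v) < d v)%N /\ exists2 x, c x = v & c (iota x) = par v.

(** The tree is given by parents and a rank that decreases towards the root;
    the distance from the root serves as rank. *)
Lemma spanning_tree_exists (V : finType) (g : X -> X) (c : X -> V) (r : V) :
  gluing g c -> exists par d, spanning_tree c r par d.
Proof.
move=> gl.
pose grow (S : {set V}) := (S :|: [set c (iota x) | x in X & c x \in S])%SET.
pose ball n := iter n grow [set r]%SET.
have reach v : exists n, v \in ball n.
  pose S := [set v | `[< exists n, v \in ball n >]]%SET.
  have : v \in S.
    apply: (gl_connected gl (S := S) _ (a := r)).
      move=> x; rewrite [_ \in S]finset.in_set => /asboolP[n xn].
      rewrite finset.in_set; apply/asboolP; exists n.+1.
      rewrite /= finset.in_setU; apply/orP; right.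
      by apply/imsetP; exists x; rewrite // inE xn andbT.
    by rewrite finset.in_set; apply/asboolP; exists 0%N; rewrite inE.
  by rewrite finset.in_set => /asboolP.
pose d v := ex_minn (reach v).
have step v : v != r -> exists u, (d u < d v)%N /\
    exists2 x, c x = v & c (iota x) = u.
  move=> vr; rewrite /d; case: ex_minnP => -[|n] vn nmin.
    by rewrite inE (negbTE vr) in vn.
  move: vn; rewrite /= finset.in_setU => /orP[vn|].
    by have := nmin n vn; rewrite ltnn.
  move=> /imsetP[x]; rewrite !inE => /= xn ->.
  exists (c x); split; last by exists (iota x); rewrite ?iotaK.
  by case: ex_minnP => m _ /(_ n xn).
have {step} stepP v : exists u, v != r -> (d u < d v)%N /\
    exists2 x, c x = v & c (iota x) = u.
  have [->|/step[u Hu]] := eqVneq v r; first by exists r.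
  by exists u.
by have [par parP] := choice stepP; exists par, d => v /parP.
Qed.

Definition child_flags (V : finType) (c : X -> V) (r : V) (par : V -> V) :
    {set X} :=
  [set x | (c x != r) && (c (iota x) == par (c x))]%SET.

(** The four flags of a glued edge are distinct, so one of them can be chosen
    from each edge. *)
Lemma gluing_transversal (V : finType) (g : X -> X) (c : X -> V) (A : {set X}) :
  gluing g c -> {in A, forall x, iota x \in A} -> {in A, forall x, g x \in A} ->
  exists T : {set X}, [/\ T \subset A, (4 * #|T| = #|A|)%N &
    forall a, a \in A ->
      exists2 t, t \in T & a \in [:: t; iota t; g t; iota (g t)]].
Proof.
move=> gl; elim: {A}#|A| {-2}A (leqnn #|A|) => [|n IHn] A.
  rewrite leqn0 cards_eq0 => /eqP -> _ _; exists finset.set0.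
  by split; [exact: finset.sub0set|rewrite cards0|move=> a; rewrite inE].
move=> leA Ai Ag; have [->|/finset.set0Pn[y yA]] := eqVneq A finset.set0.
  exists finset.set0.
  by split; [exact: finset.sub0set|rewrite cards0|move=> a; rewrite inE].
have gi := gl_iota gl; have gK := gl_inv gl.
have gy_iy : g y != iota y.
  by apply: contraNneq (gl_noloop gl y) => <-; rewrite (gl_vg gl).
pose O := [:: y; iota y; g y; iota (g y)].
have uO : uniq O.
  have n1 : y != iota y by rewrite eq_sym.
  have n2 : y != g y by rewrite eq_sym (gl_fpf gl).
  have n3 : y != iota (g y).
    by apply: contra gy_iy => /eqP E; rewrite [X in _ == iota X]E iotaK.
  have n4 : iota y != g y by rewrite eq_sym.
  have n5 : iota y != iota (g y) by rewrite (inj_eq (inv_inj iotaK)).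
  have n6 : g y != iota (g y) by rewrite eq_sym.
  by rewrite /= !inE !negb_or n1 n2 n3 n4 n5 n6.
have Oi x : (iota x \in O) = (x \in O).
  rewrite /O !inE !(inv_eq iotaK) !iotaK.
  by rewrite orbCA orbA -!orbA; do !bool_congr.
have Og x : (g x \in O) = (x \in O).
  rewrite /O !inE !(inv_eq gK) !gi !gK.
  by case: (x == y); case: (x == iota y); case: (x == g y); case: (x == _).
have OA : {subset O <= A}.
  by move=> x; rewrite !inE => /or4P[] /eqP ->; rewrite ?Ai ?Ag.
pose A' := (A :\: [set x in O])%SET.
have cA : #|A| = (4 + #|A'|)%N.
  rewrite -(cardsID [set x in O]%SET A) -/A'; congr (_ + _)%N.
  rewrite (_ : A :&: _ = [set x in O])%SET; last first.
    apply/setP => x; rewrite !inE.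
    by apply/idP/idP => [/andP[]//|xO]; rewrite xO andbT; apply: OA; rewrite /O !inE.
  by rewrite cardsE (card_uniqP uO).
have leA' : (#|A'| <= n)%N by move: leA; rewrite cA; lia.
have [||T [TA' cT HT]] := IHn A' leA'.
- by move=> x; rewrite !finset.in_setD !finset.in_set Oi => /andP[-> /Ai].
- by move=> x; rewrite !finset.in_setD !finset.in_set Og => /andP[-> /Ag].
have yT : y \notin T.
  by apply/negP => /(fintype.subsetP TA'); rewrite !inE eqxx.
exists (y |: T)%SET; split.
- rewrite finset.subUset finset.sub1set yA /=.
  by apply: fintype.subset_trans TA' _; apply: finset.subsetDl.
- by rewrite finset.cardsU1 yT cA mulnDr cT.
move=> a aA; have [aO|aO] := boolP (a \in O).
  by exists y => //; rewrite !inE eqxx.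
have [|t tT at_] := HT a; first by rewrite finset.in_setD finset.in_set aO.
by exists t => //; rewrite !inE tT orbT.
Qed.

(** What has to be remembered of a gluing: the flags at the child end of an edge
    of a spanning tree, one flag for each of the other edges, and the partners
    of the latter. *)
Definition gluing_code (V : finType) (n : nat) (g : X -> X)
    (k : {set X} * {set X} * n.-tuple X) : Prop :=
  exists (c : X -> V) r par d,
    [/\ gluing g c, spanning_tree c r par d, k.1.1 = child_flags c r par,
      k.2 = [seq g x | x <- enum k.1.2] :> seq X &
      forall x, x \notin k.1.1 -> iota x \notin k.1.1 ->
        exists2 t, t \in k.1.2 & x \in [:: t; iota t; g t; iota (g t)]].

(** Each vertex other than the root has one parent edge, with two sides. *)
Lemma child_flags_card (V : finType) (g : X -> X) (c : X -> V) r par d :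
  gluing g c -> spanning_tree c r par d ->
  #|child_flags c r par| = (2 * #|V|.-1)%N.
Proof.
move=> gl tree; set Ch := child_flags c r par.
rewrite -sum1_card (partition_big c (predC1 r)) /=; last first.
  by move=> x; rewrite finset.in_set => /andP[].
rewrite (eq_bigr (fun => 2)%N) => [|v vr].
  by rewrite sum_nat_const (cardC1 r) mulnC.
have [_ [x xv xpar]] := tree v vr.
rewrite sum1_card -(_ : #|[set x; g x]%SET| = 2)%N; last first.
  by rewrite cards2 eq_sym (gl_fpf gl).
apply: eq_card => y; rewrite !inE -!topredE /=.
rewrite finset.in_set; apply/idP/idP => [/andP[/andP[_ /eqP yp] /eqP yv]|].
  have cxy : c x = c y by rewrite xv yv.
  have cixy : c (iota x) = c (iota y) by rewrite xpar yp yv.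
  by have [->|->] := gl_simple gl cxy cixy; rewrite ?eqxx ?orbT.
by case/orP => /eqP ->;
  rewrite -?(gl_iota gl) ?(gl_vg gl) xv xpar vr !eqxx.
Qed.

Lemma gluing_code_exists (V : finType) (g : X -> X) (c : X -> V) (r : V) :
  gluing g c -> exists n, (4 * (n + #|V|.-1) = #|X|)%N /\
    exists k : {set X} * {set X} * n.-tuple X, gluing_code V g k.
Proof.
move=> gl; have [par [d tree]] := spanning_tree_exists r gl.
pose Ch := child_flags c r par.
have Chg x : (g x \in Ch) = (x \in Ch).
  by rewrite !finset.in_set -(gl_iota gl) !(gl_vg gl).
have Chi x : x \in Ch -> iota x \notin Ch.
  rewrite !finset.in_set => /andP[xr /eqP xp]; rewrite negb_and negbK.
  have [//|ixr] /= := boolP (c (iota x) == r); apply/eqP; rewrite iotaK => ixp.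
  have [lt1 _] := tree _ xr; have [lt2 _] := tree _ ixr.
  by rewrite -ixp xp in lt2; rewrite -xp in lt1; have := ltn_trans lt1 lt2; rewrite -xp ltnn.
pose A := [set x | (x \notin Ch) && (iota x \notin Ch)]%SET.
have AP x : (x \in A) = (x \notin Ch) && (iota x \notin Ch).
  by rewrite finset.in_set.
have [||T [TA cT HT]] := gluing_transversal (A := A) gl.
- by move=> x; rewrite !AP iotaK andbC.
- by move=> x; rewrite !AP -(gl_iota gl) !Chg.
have cX : (4 * (#|T| + #|V|.-1))%N = #|X|.
  have cCh := child_flags_card gl tree.
  have cB : #|(Ch :|: [set iota x | x in Ch])%SET| = (4 * #|V|.-1)%N.
    rewrite cardsU (_ : _ :&: _ = finset.set0)%SET; last first.
      apply/setP => x; rewrite finset.in_setI finset.in_set0.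
      apply/negP => /andP[xC /imsetP[y yC xy]].
      by move: (Chi y yC); rewrite -xy xC.
    by rewrite cards0 subn0 card_imset ?cCh; [lia|exact: inv_inj].
  have AE : A = (~: (Ch :|: [set iota x | x in Ch]))%SET.
    apply/setP => x; rewrite AP finset.in_setC finset.in_setU negb_or.
    congr (_ && ~~ _); apply/idP/imsetP => [ixC|[y yC ->]].
      by exists (iota x); rewrite ?iotaK.
    by rewrite iotaK.
  by have := cardsC (Ch :|: [set iota x | x in Ch])%SET; rewrite -AE cB; lia.
have sT : size [seq g x | x <- enum T] == #|T|.
  by rewrite size_map -cardE.
exists #|T|; split=> //; exists (Ch, T, Tuple sT), c, r, par, d.
split=> //= x xC ixC.
by apply: HT; rewrite AP xC.
Qed.

(** The gluing of the tree edges is forced.  Two gluings with the same code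
    agree off the tree; if they disagree somewhere, take a disagreement on a
    tree edge whose child [v] is as deep as possible.  All other edges at [v]
    are then glued in the same way, and following them around [v] from one side
    of the tree edge leads to its other side, since by parity a component of
    the flags at [v] cannot have a single loose end. *)
Lemma gluing_code_inj (V : finType) (n : nat) (g g' : X -> X)
    (k : {set X} * {set X} * n.-tuple X) :
  gluing_code V g k -> gluing_code V g' k -> g =1 g'.
Proof.
case: k => -[Ch T] s [c [r [par [d]]]] /= [gl tree ChE sE cover].
move=> [c' [r' [par' [d']]]] /= [gl' tree' ChE' sE' _].
pose agree := [set x | g x == g' x]%SET.
have agreeP x : reflect (g x = g' x) (x \in agree).
  by rewrite finset.in_set; apply: eqP.
have agi x : x \in agree -> iota x \in agree.
  by move=> /agreeP xg; apply/agreeP; rewrite (gl_iota gl) (gl_iota gl') xg.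
have agg x : x \in agree -> g x \in agree.
  by move=> /agreeP xg; apply/agreeP; rewrite (gl_inv gl) xg (gl_inv gl').
have agT t : t \in T -> t \in agree.
  move=> tT; apply/agreeP; have : [seq g x | x <- enum T] = [seq g' x | x <- enum T].
    by rewrite -sE -sE'.
  by move=> /eq_in_map; apply; rewrite mem_enum.
suff all_agree : [forall x, x \in agree] by move=> x; apply/agreeP/forallP.
apply: contraT; rewrite negb_forall => /existsP[x0 x0n].
have [x1 x1P] : exists x1, (x1 \in Ch) && (x1 \notin agree).
  have [x0C|x0C] := boolP (x0 \in Ch); first by exists x0; rewrite x0C.
  have [ix0C|ix0C] := boolP (iota x0 \in Ch).
    exists (iota x0); rewrite ix0C /=; apply: contra x0n => /agi.
    by rewrite iotaK.
  have [t /agT ta] := cover _ x0C ix0C; rewrite !inE => x0t.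
  by case/negP: x0n; case/or4P: x0t => /eqP ->; auto.
case: (@arg_maxnP _ x1 [pred x | (x \in Ch) && (x \notin agree)]
  (fun x => d (c x)) x1P) => x /andP[xC xn] xmax.
have Chg y : y \in Ch -> g y \in Ch.
  by rewrite ChE !finset.in_set -(gl_iota gl) !(gl_vg gl).
(* Any other disagreement at this vertex would be at the parent end of a tree
   edge, whose child is deeper. *)
have loose y : c y = c x -> y \notin agree -> y = x \/ y = g x.
  move=> yx yn; have [yC|yC] := boolP (y \in Ch).
    apply: (gl_simple gl) => //; move: yC xC.
    by rewrite ChE !finset.in_set => /andP[_ /eqP ->] /andP[_ /eqP ->]; rewrite yx.
  have [iyC|iyC] := boolP (iota y \in Ch); last first.
    have [t /agT ta] := cover _ yC iyC; rewrite !inE => yt.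
    by case/negP: yn; case/or4P: yt => /eqP ->; auto.
  have iyn : iota y \notin agree by apply: contra yn => /agi; rewrite iotaK.
  have := xmax (iota y); rewrite /= iyC iyn => /(_ isT).
  move: iyC; rewrite ChE finset.in_set iotaK => /andP[iyr /eqP yp].
  by have [] := tree _ iyr; rewrite -yp yx ltnNge => /negP.
pose e : rel X := fun y z => (z == beta y) || (y \in agree) && (z == g y).
pose C := [set y | connect e x y]%SET.
have CP y : (y \in C) = connect e x y by rewrite finset.in_set.
have Cx : x \in C by rewrite CP connect0.
have Cb y : y \in C -> beta y \in C.
  rewrite !CP => xy; apply: connect_trans xy (connect1 _).
  by rewrite /e eqxx.
have Cg y : y \in C -> y \in agree -> g y \in C.
  rewrite !CP => xy ya; apply: connect_trans xy (connect1 _).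
  by rewrite /e ya eqxx orbT.
have inv_along (W : finType) (h : X -> W) :
    (forall y z, e y z -> h z = h y) -> forall y, y \in C -> h y = h x.
  move=> he y; rewrite CP => /connectP[p + ->].
  elim: p x {xC xn xmax loose C CP Cx Cb Cg} => //= z p IHp y0 /andP[/he <-].
  exact: IHp.
have Cc y : y \in C -> c y = c x.
  apply: inv_along => {}y z; rewrite /e => /orP[/eqP ->|/andP[_ /eqP ->]].
    by rewrite (gl_vbeta gl).
  by rewrite (gl_vg gl).
have Cc' y : y \in C -> c' y = c' x.
  apply: inv_along => {}y z; rewrite /e => /orP[/eqP ->|/andP[/agreeP -> /eqP ->]].
    by rewrite (gl_vbeta gl').
  by rewrite (gl_vg gl').
have evenC : ~~ odd #|C|.
  by apply: (@even_fpf_involution _ beta) => y; auto.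
have evenCa : ~~ odd #|(C :&: agree)%SET|.
  apply: (@even_fpf_involution _ g) => y.
  - by rewrite !finset.in_setI => /andP[yC ya]; rewrite Cg ?agg.
  - by move=> _; apply: gl_inv gl _.
  - by move=> _; apply: gl_fpf gl _.
have gxC : g x \in C.
  apply: contraT => gxC; move: evenC; rewrite -(cardsID agree C).
  have -> : (C :\: agree = [set x])%SET.
    apply/setP => y; rewrite finset.in_setD finset.in_set1.
    apply/andP/eqP => [[yn yC]|->//].
    have [//|yE] := loose y (Cc y yC) yn.
    by rewrite -yE yC in gxC.
  by rewrite cards1 oddD (negbTE evenCa).
have c'gx : c' x = c' (g x) by rewrite (Cc' _ gxC).
have c'igx : c' (iota x) = c' (iota (g x)).
  have := Chg _ xC; move: xC; rewrite ChE' !finset.in_set.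
  by move=> /andP[_ /eqP ->] /andP[_ /eqP ->]; rewrite c'gx.
have [E|E] := gl_simple gl' c'gx c'igx.
- by have := gl_fpf gl x; rewrite E eqxx.
- by case/negP: xn; apply/agreeP.
Qed.

(** Of the [#|X| / 4] edges, the [#|V| - 1] tree edges cost only a constant
    factor per flag; each of the other [n] costs a factor [#|X|]. *)
Theorem gluing_count (V : finType) (r : V) (n : nat) (G : {set {ffun X -> X}}) :
  (4 * (n + #|V|.-1) = #|X|)%N ->
  (forall g : {ffun X -> X}, g \in G -> exists c : X -> V, gluing g c) ->
  (#|G| <= 2 ^ #|X| * 2 ^ #|X| * #|X| ^ n)%N.
Proof.
move=> cX GP.
have [->|/finset.set0Pn[g0 g0G]] := eqVneq G finset.set0; first by rewrite cards0.
pose code : Type := ({set X} * {set X} * n.-tuple X)%type.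
have codes g (c : X -> V) : gluing g c -> exists k : code, gluing_code V g k.
  move=> /(gluing_code_exists r)[n' [cX' H]].
  by have nn' : n' = n; [lia|rewrite nn' in H].
have codeP (g : {ffun X -> X}) : exists k : code, g \in G -> gluing_code V g k.
  have [gG|gG] := boolP (g \in G).
    by have [c gl] := GP g gG; have [k kP] := codes _ _ gl; exists k.
  by have [c gl] := GP g0 g0G; have [k0 _] := codes _ _ gl; exists k0.
have [k kP] := choice codeP.
have injk : {in G &, injective k}.
  move=> g g' gG g'G kk; apply/ffunP; apply: (@gluing_code_inj V n g g' (k g)).
    exact: kP.
  by rewrite kk; apply: kP.
rewrite -(card_in_imset injk); apply: leq_trans (max_card _) _.
have cS : #|{: {set X}}| = (2 ^ #|X|)%N.
  rewrite -[in RHS]cardsT -card_powerset; apply: eq_card => A.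
  by rewrite !inE finset.subsetT.
by rewrite !card_prod card_tuple !cS.
Qed.

End Gluings.

(** * The gluing of a triangulated surface *)

Definition i0 : 'I_3 := @Ordinal 3 0 isT.
Definition i1 : 'I_3 := @Ordinal 3 1 isT.
Definition i2 : 'I_3 := @Ordinal 3 2 isT.

(** A flag of the triangle [x.1] is an ordering [x.2] of its corners: a corner,
    the other end of a side at it, and the third corner. *)
Definition flag (f : nat) : finType := ('I_f * 'S_3)%type.

Definition flag_iota f (x : flag f) : flag f := (x.1, (tperm i0 i1 * x.2)%g).
Definition flag_beta f (x : flag f) : flag f := (x.1, (tperm i1 i2 * x.2)%g).

Lemma flag_iotaK f : involutive (@flag_iota f).
Proof. by case=> t s; rewrite /flag_iota /= mulgA tperm2 mul1g. Qed.

Lemma flag_betaK f : involutive (@flag_beta f).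
Proof. by case=> t s; rewrite /flag_beta /= mulgA tperm2 mul1g. Qed.

Lemma flag_iota_fpf f (x : flag f) : flag_iota x != x.
Proof.
apply/eqP => /(congr1 (fun y : flag f => y.2 i0)).
by rewrite /= permM tpermL => /perm_inj.
Qed.

Lemma flag_beta_fpf f (x : flag f) : flag_beta x != x.
Proof.
apply/eqP => /(congr1 (fun y : flag f => y.2 i1)).
by rewrite /= permM tpermL => /perm_inj.
Qed.

Lemma card_flag f : #|flag f| = (6 * f)%N.
Proof. by rewrite card_prod card_ord card_Sn mulnC. Qed.

Section Enumerated.
Context {f w : nat}.
Implicit Types (K : {set {set 'I_w}}) (c : 'I_f -> 'I_3 -> 'I_w) (x y : flag f).

(** A numbering of the triangles together with an ordering of the corners of
    each. *)
Definition enumerates K c : Prop :=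
  [/\ forall t, injective (c t),
      injective (fun t => [set c t i | i : 'I_3]%SET) &
      forall s, (s \in two_faces K) = [exists t, s == [set c t i | i : 'I_3]%SET]].

Definition vtx c i x := c x.1 (x.2 i).

(** Changing the third vertex alone is crossing the side between the other two. *)
Definition glues c (g : flag f -> flag f) : Prop :=
  forall x, [/\ vtx c i0 (g x) = vtx c i0 x, vtx c i1 (g x) = vtx c i1 x
    & vtx c i2 (g x) != vtx c i2 x].

Lemma enumeration_exists K : #|two_faces K| = f -> exists c, enumerates K c.
Proof.
move=> cK; pose T (t : 'I_f) := enum_val (cast_ord (esym cK) t).
have tri t : exists h : 'I_3 -> 'I_w, injective h /\ T t = [set h i | i : 'I_3]%SET.
  have := enum_valP (cast_ord (esym cK) t).
  rewrite finset.in_set -/(T t) => /andP[_ /eqP s3].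
  exists (fun i => enum_val (cast_ord (esym s3) i)); split.
    by move=> i j /enum_val_inj /cast_ord_inj.
  apply/setP => v; apply/idP/imsetP => [vs|[i _ ->]]; last exact: enum_valP.
  exists (cast_ord s3 (enum_rank_in vs v)) => //.
  by rewrite cast_ordK enum_rankK_in.
have [c cP] := choice tri; exists c; split=> [t|t u|s].
- by have [] := cP t.
- by rewrite -(cP t).2 -(cP u).2 => /enum_val_inj /cast_ord_inj.
- apply/idP/existsP => [sK|[t /eqP ->]].
    exists (cast_ord cK (enum_rank_in sK s)).
    by rewrite -(cP _).2 /T cast_ordK enum_rankK_in.
  by rewrite -(cP t).2; apply: enum_valP.
Qed.

Lemma enumerates_perm K c (p : 'S_f) :
  enumerates K c -> enumerates K (fun t => c (p t)).
Proof.
move=> [c1 c2 c3]; split=> [t|t u|s]; first exact: c1.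
  by move=> /c2 /perm_inj.
rewrite c3; apply/existsP/existsP => -[t /eqP st].
  by exists ((p^-1)%g t); rewrite permKV st.
by exists (p t); rewrite st.
Qed.

Section Flags.
Context {K : {set {set 'I_w}}} {c : 'I_f -> 'I_3 -> 'I_w}.
Hypotheses (sK : combinatorial_surface K) (cE : enumerates K c).

Lemma ord3P (i : 'I_3) : [\/ i = i0, i = i1 | i = i2].
Proof.
by case: i => [[|[|[|//]]]] ?; [constructor 1|constructor 2|constructor 3];
  apply: val_inj.
Qed.

Lemma vtx_iota x : [/\ vtx c i0 (flag_iota x) = vtx c i1 x,
  vtx c i1 (flag_iota x) = vtx c i0 x & vtx c i2 (flag_iota x) = vtx c i2 x].
Proof. by rewrite /vtx /= !permM tpermL tpermR tpermD. Qed.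

Lemma vtx_beta x : [/\ vtx c i0 (flag_beta x) = vtx c i0 x,
  vtx c i1 (flag_beta x) = vtx c i2 x & vtx c i2 (flag_beta x) = vtx c i1 x].
Proof. by rewrite /vtx /= !permM tpermL tpermR tpermD. Qed.

Lemma triangle_vtx x :
  [set c x.1 i | i : 'I_3]%SET = [set vtx c i0 x; vtx c i1 x; vtx c i2 x]%SET.
Proof.
apply/setP => v; apply/imsetP/idP => [[i _ ->]|].
  have [j ->] : exists j, i = x.2 j by exists ((x.2^-1)%g i); rewrite permKV.
  by rewrite !inE; case: (ord3P j) => ->; rewrite eqxx ?orbT.
by rewrite !inE => /orP[/orP[]|] /eqP ->;
  [exists (x.2 i0)|exists (x.2 i1)|exists (x.2 i2)].
Qed.

Lemma flag_face x : face K (vtx c i0 x) (vtx c i1 x) (vtx c i2 x).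
Proof.
have [c1 c2 c3] := cE; rewrite /face /vtx !(inj_eq (c1 _)) !(inj_eq perm_inj) /=.
have : [set c x.1 i | i : 'I_3]%SET \in two_faces K.
  by rewrite c3; apply/existsP; exists x.1.
by rewrite triangle_vtx finset.in_set => /andP[].
Qed.

Lemma flag_eq x y : (forall i, vtx c i x = vtx c i y) -> x = y.
Proof.
have [c1 c2 c3] := cE => xy.
have E1 : x.1 = y.1.
  by apply: c2; rewrite (triangle_vtx x) (triangle_vtx y) !xy.
rewrite [x]surjective_pairing [y]surjective_pairing E1; congr (_, _).
by apply/permP => i; apply: (c1 x.1); rewrite {2}E1; apply: xy.
Qed.

Lemma flag_exists a b d : face K a b d ->
  exists x, [/\ vtx c i0 x = a, vtx c i1 x = b & vtx c i2 x = d].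
Proof.
have [c1 c2 c3] := cE => /and4P[ab ad bd abd].
have : [set a; b; d]%SET \in two_faces K.
  rewrite finset.in_set abd /= finset.setUC finset.cardsU1 !inE negb_or.
  by rewrite !(eq_sym d) ad bd cards2 ab.
rewrite c3 => /existsP[t /eqP E].
have mem v : v \in [set a; b; d]%SET -> exists i, c t i = v.
  by rewrite E => /imsetP[i _ ->]; exists i.
have [ia Ea] : exists i, c t i = a by apply: mem; rewrite !inE eqxx.
have [ib Eb] : exists i, c t i = b by apply: mem; rewrite !inE eqxx orbT.
have [id Ed] : exists i, c t i = d by apply: mem; rewrite !inE eqxx orbT.
pose h (i : 'I_3) := if i == i0 then ia else if i == i1 then ib else id.
have hI : injective h.
  have nab : ia != ib by apply: contraNneq ab => E'; rewrite -Ea -Eb E'.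
  have nad : ia != id by apply: contraNneq ad => E'; rewrite -Ea -Ed E'.
  have nbd : ib != id by apply: contraNneq bd => E'; rewrite -Eb -Ed E'.
  move=> i j; rewrite /h.
  case: (ord3P i) => ->; case: (ord3P j) => -> //= /eqP;
    rewrite ?(negbTE nab) ?(negbTE nad) ?(negbTE nbd) //;
    by rewrite eq_sym ?(negbTE nab) ?(negbTE nad) ?(negbTE nbd).
exists (t, perm hI); rewrite /vtx /= !permE /h /=.
by split.
Qed.

Lemma glues_exists : exists g : {ffun flag f -> flag f}, glues c g.
Proof.
have H x : exists y, [/\ vtx c i0 y = vtx c i0 x, vtx c i1 y = vtx c i1 x
    & vtx c i2 y != vtx c i2 x].
  have [d dn Fd] := cs_other sK (flag_face x).
  by have [y [y0 y1 y2]] := flag_exists Fd; exists y; rewrite y0 y1 y2.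
by have [g gP] := choice H; exists (finfun g) => x; rewrite ffunE; apply: gP.
Qed.

Lemma glues_cases g x y : glues c g -> vtx c i0 y = vtx c i0 x ->
  vtx c i1 y = vtx c i1 x -> y = x \/ y = g x.
Proof.
move=> gP y0 y1; have [g0 g1 g2] := gP x.
have Fx := flag_face x; have := flag_face y; have := flag_face (g x).
rewrite g0 g1 y0 y1 => Fg Fy; case: (cs_two sK Fx Fg Fy) => E.
- by rewrite E eqxx in g2.
- by left; apply: flag_eq => i; case: (ord3P i) => ->.
- by right; apply: flag_eq => i; case: (ord3P i) => ->; rewrite ?g0 ?g1.
Qed.

Lemma glues_neq g x : glues c g -> g x != x.
Proof. by move=> gP; have [_ _] := gP x; apply: contraNneq => ->. Qed.

Lemma glues_gluing g : glues c g -> gluing (@flag_iota f) (@flag_beta f) g (vtx c i0).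
Proof.
move=> gP; split.
- move=> x; have [h0 h1 _] := gP x; have [k0 k1 _] := gP (g x).
  have [//|E] := glues_cases gP (etrans k0 h0) (etrans k1 h1).
  by have := glues_neq (g x) gP; rewrite E eqxx.
- by move=> x; apply: glues_neq.
- move=> x; have [a0 a1 a2] := vtx_iota x; have [b0 b1 b2] := vtx_iota (g x).
  have [h0 h1 h2] := gP x.
  have e0 : vtx c i0 (flag_iota (g x)) = vtx c i0 (flag_iota x).
    by rewrite b0 a0.
  have e1 : vtx c i1 (flag_iota (g x)) = vtx c i1 (flag_iota x).
    by rewrite b1 a1.
  have [/(inv_inj (@flag_iotaK f)) E|//] := glues_cases gP e0 e1.
  by have := glues_neq x gP; rewrite E eqxx.
- by move=> x; have [] := vtx_beta x.
- by move=> x; have [] := gP x.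
- move=> x; have [-> _ _] := vtx_iota x; have /and4P[+ _ _ _] := flag_face x.
  by rewrite eq_sym.
- move=> x y; have [-> _ _] := vtx_iota x; have [-> _ _] := vtx_iota y.
  by move=> xy0 xy1; apply: glues_cases.
- move=> S Scl; apply: (cs_connected sK) => a b aS /(cs_face sK)[d F].
  have [x [x0 x1 _]] := flag_exists F.
  have [i0x _ _] := vtx_iota x; have := Scl x; rewrite i0x x0 x1; exact.
Qed.

(** Since links are connected, the flags at a vertex form one orbit under
    [flag_beta] and [g]; so the gluing alone determines the vertices. *)
Lemma link_orbit (W : Type) (h : flag f -> W) g : glues c g ->
  (forall x, h (flag_beta x) = h x) -> (forall x, h (g x) = h x) ->
  forall x y, vtx c i0 x = vtx c i0 y -> h x = h y.
Proof.
move=> gP hb hg x y xy.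
pose v := vtx c i0 y.
pose S := [set b | `[< forall z, vtx c i0 z = v -> vtx c i1 z = b -> h z = h y >]]%SET.
have SP b : reflect (forall z, vtx c i0 z = v -> vtx c i1 z = b -> h z = h y) (b \in S).
  by rewrite finset.in_set; apply: asboolP.
have same z z' : vtx c i0 z = vtx c i0 z' -> vtx c i1 z = vtx c i1 z' -> h z = h z'.
  by move=> z0 z1; case: (glues_cases gP z0 z1) => ->.
have Scl b d : b \in S -> face K v b d -> d \in S.
  move=> /SP bS /flag_exists[z [z0 z1 z2]]; apply/SP => z' z'0 z'1.
  have [t0 t1 t2] := vtx_beta z.
  rewrite -(bS z z0 z1) -(hb z); apply: same; first by rewrite t0 z0.
  by rewrite t1 z2.
have yS : vtx c i1 y \in S by apply/SP => z z0 z1; apply: same.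
have edge_flag z : vtx c i0 z = v -> edge K v (vtx c i1 z).
  by move=> <-; apply: (face_edge (cs_complex sK) (flag_face z)).
by move/SP: (cs_link sK Scl yS (edge_flag y erefl) (edge_flag x xy)); apply.
Qed.

Lemma flag_transitive (S : {set flag f}) g x0 : glues c g ->
  (forall x, x \in S -> flag_beta x \in S) ->
  (forall x, x \in S -> flag_iota x \in S) ->
  (forall x, x \in S -> g x \in S) -> x0 \in S -> forall x, x \in S.
Proof.
move=> gP Sb Si Sg x0S.
have gl := glues_gluing gP.
have orbit := link_orbit (h := fun x => x \in S) gP.
have {}orbit x y : vtx c i0 x = vtx c i0 y -> (x \in S) = (y \in S).
  apply: orbit => {x y} x; apply/idP/idP => H; auto.
    by rewrite -[x](@flag_betaK f); apply: Sb.
  by rewrite -[x](gl_inv gl); apply: Sg.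
pose P := [set v | [forall x, (vtx c i0 x == v) ==> (x \in S)]]%SET.
have PP v : reflect (forall x, vtx c i0 x = v -> x \in S) (v \in P).
  rewrite finset.in_set; apply: (iffP forallP) => H x.
    by move=> xv; have := H x; rewrite xv eqxx.
  by apply/implyP => /eqP; apply: H.
have x0P : vtx c i0 x0 \in P by apply/PP => x xv; rewrite (orbit x x0).
move=> x; apply: (PP (vtx c i0 x) _) => //.
suff Pcl a b : a \in P -> edge K a b -> b \in P.
  exact: (cs_connected sK Pcl) x0P.
move=> /PP aP /(cs_face sK)[d F].
have [y [y0 y1 _]] := flag_exists F; apply/PP => z zb.
have [t0 _ _] := vtx_iota y.
by rewrite (orbit z (flag_iota y)) ?Si ?aP // t0 y1.
Qed.

Lemma vtx_surjective v x0 : exists x : flag f, vtx c i0 x = v.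
Proof.
have gl : forall S : {set 'I_w}, (forall x, vtx c i0 x \in S -> vtx c i1 x \in S) ->
    forall a b, a \in S -> b \in S.
  move=> S Scl; apply: (cs_connected sK) => a b aS /(cs_face sK)[d F].
  by have [x [x0' x1 _]] := flag_exists F; rewrite -x1; apply: Scl; rewrite x0'.
have : v \in [set vtx c i0 x | x : flag f]%SET.
  apply: (gl _ _ (vtx c i0 x0)); last by apply/imsetP; exists x0.
  move=> x _; apply/imsetP; exists (flag_iota x) => //.
  by have [-> _ _] := vtx_iota x.
by case/imsetP => x _ ->; exists x.
Qed.

Lemma surface_pure s x0 : (s \in K) =
  (s != finset.set0) && [exists t, s \subset [set c t i | i : 'I_3]%SET].
Proof.
have cK := cs_complex sK; apply/idP/andP => [sK'|[s0 /existsP[t st]]]; last first.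
  apply: (complex_sub cK _ s0 st); have [_ _ c3] := cE.
  have : [set c t i | i : 'I_3]%SET \in two_faces K.
    by rewrite c3; apply/existsP; exists t.
  by rewrite finset.in_set => /andP[].
have s0 : s != finset.set0 by apply: contraTneq sK' => ->; have /and3P[] := cK.
split=> //; have /finset.set0Pn[a sa] := s0.
have flagT x : (forall v, v \in s -> [\/ v = vtx c i0 x, v = vtx c i1 x | v = vtx c i2 x]) ->
    [exists t, s \subset [set c t i | i : 'I_3]%SET].
  move=> H; apply/existsP; exists x.1; rewrite triangle_vtx.
  by apply/fintype.subsetP => v /H []->; rewrite !inE eqxx ?orbT.
have [sa1|] := boolP (s \subset [set a]%SET).
  have [x xa] := vtx_surjective a x0; apply: (flagT x) => v /(fintype.subsetP sa1).
  by rewrite inE => /eqP ->; rewrite xa; constructor 1.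
case/subsetPn => b sb; rewrite inE => ba.
have eab : edge K a b by apply: (edge_sub cK sK') => //; rewrite eq_sym.
have [sab|] := boolP (s \subset [set a; b]%SET).
  have [d F] := cs_face sK eab; have [x [xa xb _]] := flag_exists F.
  apply: (flagT x) => v /(fintype.subsetP sab).
  by rewrite !inE => /orP[] /eqP ->; rewrite -?xa -?xb; [constructor 1|constructor 2].
case/subsetPn => d sd; rewrite !inE negb_or => /andP[da db].
have F : face K a b d by apply: (face_sub cK sK') => //; rewrite eq_sym.
have [x [xa xb xd]] := flag_exists F; apply: (flagT x) => v vs.
have sE : [set a; b; d]%SET = s.
  apply/eqP; rewrite eqEcard !finset.subUset !finset.sub1set sa sb sd /=.
  apply: leq_trans (cs_dim sK sK') _.
  by rewrite finset.setUC finset.cardsU1 !inE negb_or da db cards2 eq_sym ba.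
by move: vs; rewrite -sE !inE -xa -xb -xd => /orP[/orP[]|] /eqP ->;
  [constructor 1|constructor 2|constructor 3].
Qed.

End Flags.
End Enumerated.

(** * Isomorphism classes *)

Lemma simplicial_iso_sym w : symmetric (@simplicial_iso w).
Proof.
suff H (K L : {set {set 'I_w}}) : simplicial_iso K L -> simplicial_iso L K.
  by move=> K L; apply/idP/idP; apply: H.
move=> /existsP[g /forallP gP]; apply/existsP; exists (g^-1)%g; apply/forallP => s.
have /eqP := gP [set (g^-1)%g v | v in s]%SET.
suff -> : [set g v | v in [set (g^-1)%g v | v in s]]%SET = s by move->.
by rewrite -imset_comp -[RHS]imset_id; apply: eq_imset => v /=; rewrite permKV.
Qed.

Lemma simplicial_iso_trans w (K L M : {set {set 'I_w}}) :
  simplicial_iso K L -> simplicial_iso L M -> simplicial_iso K M.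
Proof.
move=> /existsP[g /forallP gP] /existsP[h /forallP hP].
apply/existsP; exists (g * h)%g; apply/forallP => s.
have -> : [set (g * h)%g v | v in s]%SET = [set h v | v in [set g v | v in s]]%SET.
  by rewrite -imset_comp; apply: eq_imset => v /=; rewrite permM.
by rewrite (eqP (gP s)) (hP _).
Qed.

Section SameGluing.
Context {f w : nat} (K K' : {set {set 'I_w}}) (c c' : 'I_f -> 'I_3 -> 'I_w).
Hypotheses (sK : combinatorial_surface K) (sK' : combinatorial_surface K').
Hypotheses (cE : enumerates K c) (cE' : enumerates K' c').
Context (g : flag f -> flag f) (x0 : flag f).
Hypotheses (gP : glues c g) (gP' : glues c' g).

Lemma vtx_transfer : exists phi : 'I_w -> 'I_w,
  forall x, phi (vtx c i0 x) = vtx c' i0 x.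
Proof.
have [x_ x_P] := choice (fun v => vtx_surjective sK cE v x0).
exists (fun v => vtx c' i0 (x_ v)) => x.
apply: (link_orbit sK cE gP (h := vtx c' i0)) => [y|y|]; last exact: x_P.
  by have [] := vtx_beta (c := c') y.
by have [] := gP' y.
Qed.

End SameGluing.

(** By [link_orbit] the gluing determines which corners are identified, and a
    surface is determined by its triangles by [surface_pure]. *)
Lemma same_gluing_iso f w (K K' : {set {set 'I_w}}) (c c' : 'I_f -> 'I_3 -> 'I_w)
    (g : flag f -> flag f) (x0 : flag f) :
  combinatorial_surface K -> combinatorial_surface K' ->
  enumerates K c -> enumerates K' c' -> glues c g -> glues c' g ->
  simplicial_iso K K'.
Proof.
move=> sK sK' cE cE' gP gP'.
have [phi phiP] := vtx_transfer sK cE x0 gP gP'.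
have [psi psiP] := vtx_transfer sK' cE' x0 gP' gP.
have phiK : cancel phi psi.
  by move=> v; have [x <-] := vtx_surjective sK cE v x0; rewrite phiP psiP.
have phiI := can_inj phiK.
have phit t i : phi (c t i) = c' t i.
  have := phiP (t, tperm i0 i); rewrite /vtx /= tpermL //.
apply/existsP; exists (perm phiI); apply/forallP => s; apply/eqP.
rewrite (eq_imset (g := phi)) => [|v]; last by rewrite permE.
rewrite (surface_pure sK cE s x0) (surface_pure sK' cE' _ x0); congr andb.
  by rewrite imset_eq0.
apply: eq_existsb => t.
have -> : [set c' t i | i : 'I_3]%SET = [set phi v | v in [set c t i | i : 'I_3]]%SET.
  by rewrite -imset_comp; apply: eq_imset => i /=; rewrite phit.
apply/idP/idP => [|H]; first exact: imsetS.
apply/fintype.subsetP => v vs.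
by have /imsetP[u us /phiI ->] := fintype.subsetP H _ (imset_f phi vs).
Qed.

(** Flags are permuted transitively by the three moves, so two numberings with
    the same gluing agree everywhere once they agree at one triangle. *)
Lemma gluing_rigid f w (K : {set {set 'I_w}}) (c : 'I_f -> 'I_3 -> 'I_w)
    (g : flag f -> flag f) (p q : 'S_f) (t0 : 'I_f) :
  combinatorial_surface K -> enumerates K c ->
  glues (fun t => c (p t)) g -> glues (fun t => c (q t)) g -> p t0 = q t0 ->
  p = q.
Proof.
move=> sK cE gp gq pq0; pose cp t := c (p t); pose cq t := c (q t).
have cpE : enumerates K cp := enumerates_perm p cE.
have cqE : enumerates K cq := enumerates_perm q cE.
pose S := [set x : flag f | [forall i, vtx cp i x == vtx cq i x]]%SET.
have SP x : reflect (forall i, vtx cp i x = vtx cq i x) (x \in S).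
  by rewrite finset.in_set; apply: (iffP forallP) => H i; [exact/eqP|apply/eqP].
have allS x : x \in S.
  apply: (flag_transitive sK cpE gp (x0 := (t0, 1%g))).
  - move=> y /SP yS; apply/SP => i.
    have [a0 a1 a2] := vtx_beta (c := cp) y; have [b0 b1 b2] := vtx_beta (c := cq) y.
    by case: (ord3P i) => ->; rewrite ?a0 ?a1 ?a2 ?b0 ?b1 ?b2 yS.
  - move=> y /SP yS; apply/SP => i.
    have [a0 a1 a2] := vtx_iota (c := cp) y; have [b0 b1 b2] := vtx_iota (c := cq) y.
    by case: (ord3P i) => ->; rewrite ?a0 ?a1 ?a2 ?b0 ?b1 ?b2 yS.
  - move=> y /SP yS; have [a0 a1 a2] := gp y; have [b0 b1 b2] := gq y.
    have E0 : vtx cp i0 (g y) = vtx cq i0 (g y) by rewrite a0 b0 yS.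
    have E1 : vtx cp i1 (g y) = vtx cq i1 (g y) by rewrite a1 b1 yS.
    have Fy := flag_face cpE y; have Fp := flag_face cpE (g y).
    have := flag_face cqE (g y); rewrite -E0 -E1 a0 a1 => Fq.
    rewrite a0 a1 in Fp.
    have E2 : vtx cp i2 (g y) = vtx cq i2 (g y).
      case: (cs_two sK Fy Fp Fq) => // E; first by rewrite E eqxx in a2.
      by rewrite -E yS eqxx in b2.
    by apply/SP => i; case: (ord3P i) => ->.
  - by apply/SP => i; rewrite /vtx /cp /cq /= pq0.
have [_ c2 _] := cE; apply/permP => t; apply: c2; apply: eq_imset => i.
by have /SP/(_ i) := allS (t, 1%g); rewrite /vtx /= perm1.
Qed.

Section Classes.
Context (R : realType) (f w : nat).
Hypotheses (f0 : (0 < f)%N).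

Lemma labelled_surfaceP K : K \in labelled_surfaces R f w ->
  combinatorial_surface K /\ #|two_faces K| = f.
Proof.
rewrite finset.in_set => /andP[/asboolP[tK conn] /eqP cK].
by split=> //; apply: combinatorial_surfaceP tK conn.
Qed.

(** A class has many gluings, one for each numbering of the triangles, and a
    gluing determines the class, and the numbering up to the place of one
    triangle. *)
Lemma classes_le_gluings (G : {set {ffun flag f -> flag f}}) :
  (forall (g : {ffun flag f -> flag f}) K c, combinatorial_surface K -> enumerates K c ->
     glues (w := w) c g -> g \in G) ->
  (#|surface_classes R f w| * f`! <= #|G| * f)%N.
Proof.
move=> GP; have [->|/finset.set0Pn[P0 P0D]] :=
  eqVneq (surface_classes R f w) finset.set0; first by rewrite cards0.
pose t0 : 'I_f := Ordinal f0; pose x0 : flag f := (t0, 1%g).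
have pick P : exists Kc : {set {set 'I_w}} * ('I_f -> 'I_3 -> 'I_w),
    P \in surface_classes R f w ->
    [/\ combinatorial_surface Kc.1, enumerates Kc.1 Kc.2 &
      P = [set L in labelled_surfaces R f w | simplicial_iso Kc.1 L]%SET].
  have pick1 Q : Q \in surface_classes R f w -> exists Kc :
      {set {set 'I_w}} * ('I_f -> 'I_3 -> 'I_w),
      [/\ combinatorial_surface Kc.1, enumerates Kc.1 Kc.2 &
        Q = [set L in labelled_surfaces R f w | simplicial_iso Kc.1 L]%SET].
    move=> /imsetP[K KD QE]; have [sK cK] := labelled_surfaceP KD.
    by have [c cE] := enumeration_exists cK; exists (K, c); split.
  have [/pick1[Kc ?]|nP] := boolP (P \in surface_classes R f w); first by exists Kc.
  by have [Kc _] := pick1 P0 P0D; exists Kc.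
have [Kc KcP] := choice pick.
have glue (Pp : {set {set {set 'I_w}}} * 'S_f) :
    exists g : {ffun flag f -> flag f}, Pp.1 \in surface_classes R f w ->
      glues (fun t => (Kc Pp.1).2 (Pp.2 t)) g.
  have [PD|nP] := boolP (Pp.1 \in surface_classes R f w); last first.
    by exists [ffun x => x].
  have [sK cE _] := KcP _ PD.
  by have [g gP] := glues_exists sK (enumerates_perm Pp.2 cE); exists g.
have [gl glP] := choice glue.
pose code (Pp : {set {set {set 'I_w}}} * 'S_f) := (gl Pp, Pp.2 t0).
pose dom := finset.setX (surface_classes R f w) [set: 'S_f]%SET.
have inj : {in dom &, injective code}.
  move=> [P p] [Q q]; rewrite !finset.in_setX /= => /andP[PD _] /andP[QD _].
  rewrite /code /= => -[glE pq].
  have [sP cP PE] := KcP _ PD; have [sQ cQ QE] := KcP _ QD.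
  have gp := glP (P, p) PD; have gq := glP (Q, q) QD; rewrite /= in gp gq.
  rewrite -glE in gq.
  have iso : simplicial_iso (Kc P).1 (Kc Q).1.
    exact: (same_gluing_iso x0 sP sQ (enumerates_perm p cP)
      (enumerates_perm q cQ) gp gq).
  have PQ : P = Q.
    rewrite PE QE; apply/setP => L; rewrite !finset.in_set; congr (_ && _).
    apply/idP/idP => iL; apply: simplicial_iso_trans iL => //.
    by rewrite simplicial_iso_sym.
  rewrite -PQ in gq *.
  by rewrite (gluing_rigid sP cP gp gq pq).
have <- : #|dom| = (#|surface_classes R f w| * f`!)%N.
  by rewrite finset.cardsX cardsT card_Sn.
rewrite -(card_in_imset inj) -[X in (_ * X)%N](card_ord f) -[in leqRHS]cardsT.
rewrite -finset.cardsX; apply: subset_leq_card; apply/fintype.subsetP => y.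
move=> /imsetP[[P p] /finset.setXP[/= PD _] ->]; rewrite finset.in_setX finset.in_setT andbT.
have [sP cP _] := KcP _ PD.
by apply: (GP _ _ _ sP (enumerates_perm p cP)); apply: glP (P, p) PD.
Qed.

End Classes.

(** * The estimate *)

(** [n ^ n] is at most the falling factorial [(2 * n) ^_ n], which is [n`!]
    times a binomial coefficient. *)
Lemma expnn_le_fact n : (n ^ n <= 4 ^ n * n`!)%N.
Proof.
have H k : (n ^ k <= (n + k) ^_ k)%N.
  elim: k => [|k IHk]; first by rewrite ffactn0.
  rewrite addnS ffactSS expnS leq_mul //.
  by rewrite (leq_trans (leq_addr k n)) // leqnSn.
apply: leq_trans (H n) _; rewrite addnn -bin_ffact leq_mul2r orbC.
apply/orP; left.
have := Pascal 1 1 n.*2; rewrite addn1 -muln2 mulnC expnM => ->.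
rewrite mulnC muln2 (bigD1 (inord n)) //= inordK ?ltnS -?addnn ?leq_addr //.
by rewrite !exp1n !muln1 leq_addr.
Qed.

(** The bound with exponent [-w], for all [w] at once.  Counting flags of edges
    gives [n + w - 1 = 3 f / 2], hence [f] even, for the number [n] of edges off
    the tree, and [w <= 3 f] allows powers of [w] and of [f] with exponent [w]
    to be exchanged. *)
Lemma surface_classes_nat (R : realType) : exists C : nat, forall f w : nat,
  (0 < f)%N -> (0 < w)%N ->
  #|surface_classes R f w| = 0%N \/
  exists2 m, f = m.*2 & (#|surface_classes R f w| * w ^ w <= C ^ f * f ^ m)%N.
Proof.
have [a aE] : exists a, forall f, (2 ^ (6 * f) * 2 ^ (6 * f) = a ^ f)%N.
  by exists (2 ^ 6 * 2 ^ 6)%N => f; rewrite expnMn -!expnM.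
have [b bE] : exists b, forall f, (6 ^ (2 * f) = b ^ f)%N.
  by exists (6 ^ 2)%N => f; rewrite expnM.
have [d dE] : exists d, forall f, (3 ^ (3 * f) = d ^ f)%N.
  by exists (3 ^ 3)%N => f; rewrite expnM.
exists (d * (4 * (4 * (a * b))))%N => f w f0 w0.
have [->|/finset.set0Pn[P0 /imsetP[K KD _]]] :=
  eqVneq (surface_classes R f w) finset.set0; first by left; rewrite cards0.
right; pose r : 'I_w := Ordinal w0.
have [sK cK] := labelled_surfaceP KD.
have [c cE] := enumeration_exists cK.
have [g gP] := glues_exists sK cE.
have fI := @flag_iotaK f; have fB := @flag_betaK f.
have gl := glues_gluing sK cE gP.
have [n [cX _]] :=
  gluing_code_exists fI (@flag_iota_fpf f) r gl.
pose G := [set g : {ffun flag f -> flag f} | `[< exists c : flag f -> 'I_w,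
  gluing (@flag_iota f) (@flag_beta f) g c >]]%SET.
have NG : (#|surface_classes R f w| * f`! <= #|G| * f)%N.
  apply: classes_le_gluings => // g' K' c' sK' cE' gP'.
  rewrite finset.in_set; apply/asboolP; exists (vtx c' i0).
  have := glues_gluing sK' cE' gP'. exact.
have GX : (#|G| <= 2 ^ #|flag f| * 2 ^ #|flag f| * #|flag f| ^ n)%N.
  apply: (gluing_count fI (@flag_iota_fpf f) fB (@flag_beta_fpf f) r cX) => g'.
  by rewrite finset.in_set => /asboolP.
move: cX GX; rewrite card_flag card_ord => cX GX.
set N := #|surface_classes R f w| in NG *.
have [m fm] : exists m, f = m.*2 by exists f./2; lia.
have nE : (n + w = 3 * m + 1)%N by lia.
exists m => //.
have fexp : (f ^ m * f ^ m = f ^ f)%N by rewrite -expnD addnn -fm.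
have NF : (N * f ^ f <= 4 ^ f * a ^ f * (6 * f) ^ n * f)%N.
  apply: (@leq_trans (N * (4 ^ f * f`!))%N).
    by rewrite leq_mul2l expnn_le_fact orbT.
  rewrite mulnCA -!mulnA leq_mul2l; apply/orP; right.
  apply: leq_trans NG _; rewrite !mulnA leq_mul2r; apply/orP; right.
  by rewrite -aE.
have six : ((6 * f) ^ n <= b ^ f * f ^ n)%N.
  rewrite expnMn leq_mul2r -bE; apply/orP; right.
  by rewrite leq_exp2l //; lia.
have sq : (f ^ 2 <= 4 ^ f)%N.
  have -> : (4 ^ f = (2 ^ f) ^ 2)%N by rewrite -expnM mulnC expnM.
  by rewrite leq_exp2r // ltnW // ltn_expl.
have ww : (w ^ w <= d ^ f * f ^ w)%N.
  apply: (@leq_trans ((3 * f) ^ w)%N); first by rewrite leq_exp2r //; lia.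
  rewrite expnMn leq_mul2r -dE; apply/orP; right.
  by rewrite leq_exp2l //; lia.
have NW : (N * f ^ w <= (4 * (4 * (a * b))) ^ f * f ^ m)%N.
  have ff0 : (0 < f ^ f)%N by rewrite expn_gt0 f0.
  rewrite -(leq_pmul2r ff0) mulnAC.
  apply: (@leq_trans (4 ^ f * a ^ f * (b ^ f * f ^ n) * f * f ^ w)%N).
    rewrite leq_mul2r; apply/orP; right; apply: leq_trans NF _.
    by rewrite leq_mul2r leq_mul2l six !orbT.
  have -> : (4 ^ f * a ^ f * (b ^ f * f ^ n) * f * f ^ w =
      4 ^ f * (a ^ f * b ^ f) * f ^ 2 * (f ^ m * f ^ f))%N.
    have E : (f ^ n * f * f ^ w = f ^ 2 * (f ^ m * f ^ f))%N.
      by rewrite -expnSr -!expnD; congr (_ ^ _)%N; lia.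
    by rewrite -!mulnA; do 3!congr (_ * _)%N; rewrite !mulnA E !mulnA.
  rewrite -[in leqRHS]mulnA; set z := (f ^ m * f ^ f)%N.
  rewrite leq_mul2r; apply/orP; right.
  rewrite -(expnMn a b) -expnMn [in leqRHS]expnMn [in leqRHS]mulnC.
  by rewrite leq_mul2l sq orbT.
apply: (@leq_trans (N * (d ^ f * f ^ w))%N); first by rewrite leq_mul2l ww orbT.
rewrite mulnCA expnMn -mulnA leq_mul2l; apply/orP; right.
exact: NW.
Qed.

Theorem theorem5p1 (R : realType) (delta : R) (delta_gt0 : 0 < delta) :
  exists C : R, forall f w : nat, (0 < f)%N -> (0 < w)%N ->
    #|surface_classes R f w|%:R <=
      C ^+ f * f%:R `^ (f%:R / 2) * w%:R `^ (- ((1 - delta) * w%:R)).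
Proof.
have [C CP] := surface_classes_nat R; exists C%:R => f w f0 w0.
have [->|[m fm Nle]] := CP f w f0 w0.
  by rewrite !mulr_ge0 ?exprn_ge0 ?powR_ge0.
have -> : f%:R / 2 = m%:R :> R.
  by rewrite fm -muln2 natrM mulfK // pnatr_eq0.
have w1 : 1 <= w%:R :> R by rewrite ler1n.
have ww0 : 0 < w%:R ^+ w :> R by rewrite exprn_gt0 // ltr0n.
rewrite powR_mulrn //.
apply: (@le_trans _ _ (C%:R ^+ f * f%:R ^+ m / w%:R ^+ w)).
  rewrite ler_pdivlMr // -!natrX -!natrM ler_nat; exact: Nle.
rewrite ler_wpM2l ?mulr_ge0 ?exprn_ge0 //.
rewrite -powR_mulrn // -powRN; apply: ler_powR => //.
rewrite lerN2 ler_piMl //; lra.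
Qed.
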